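(* Let $w$ be a weight structure on a triangulated category $\mathcal{C}$. I. Assume that $\mathcal{C}$ satisfies the Brown representability property (and so $\mathcal{C}$ is smashing). Then there exists a $t$-structure $t^r$ right adjacent to $w$ if and only if $w$ is smashing. Moreover, $t^r$ is cosmashing (if it exists) and its heart is equivalent to the category of those additive functors $\underline{Hw}^{op}\to \mathrm{Ab}$ that respect products. II. Assume that $w$ is cosmashing and $\mathcal{C}$ satisfies the dual Brown representability property. 1. Then there exists a smashing $t$-structure $t^l$ left adjacent to $w$, and the opposite category $(\underline{Ht}^l)^{op}$ of the heart of $t^l$ is equivalent to the category of those additive functors $\underline{Hw}\to \mathrm{Ab}$ that respect products. 2. Assume that $w$ is also smashing. Then for any infinite cardinal $\alpha$ the $t$-structure $t^l$ given by the previous assertion restricts to the subcategory $\mathcal{C}^{(\alpha)}$ of $\mathcal{C}$; this restricted $t$-structure $t^{(\alpha)}$ is the only $t$-structure on $\mathcal{C}^{(\alpha)}$ that is left orthogonal to $w$ (in $\mathcal{C}$).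
   Context: All coproducts and products are small. For classes of objects $A,B$ write $A\perp B$ if every morphism from an object of $A$ to an object of $B$ is zero. A triangulated category is smashing (resp. cosmashing) if it is closed under coproducts (resp. products). A weight structure $w$ on a triangulated category $\mathcal{C}$ is a pair of classes $\mathcal{C}_{w\le 0},\mathcal{C}_{w\ge 0}\subset \operatorname{Obj}\mathcal{C}$, both closed under retracts, such that $\mathcal{C}_{w\le 0}\subset \mathcal{C}_{w\le 0}[1]$, $\mathcal{C}_{w\ge 0}[1]\subset \mathcal{C}_{w\ge 0}$, $\mathcal{C}_{w\le 0}\perp \mathcal{C}_{w\ge 0}[1]$, and every object $M$ fits into a distinguished triangle $L\to M\to R\to L[1]$ with $L\in \mathcal{C}_{w\le 0}$, $R\in \mathcal{C}_{w\ge 0}[1]$. Its heart $\underline{Hw}$ is the full subcategory on $\mathcal{C}_{w\le 0}\cap \mathcal{C}_{w\ge 0}$. $w$ is smashing if $\mathcal{C}$ is smashing and $\mathcal{C}_{w\ge 0}$ is closed under coproducts; $w$ is cosmashing if $\mathcal{C}$ is cosmashing and $\mathcal{C}_{w\le 0}$ is closed under products. A $t$-structure $t$ on $\mathcal{C}$ (homological convention) is a pair of isomorphism-closed classes $\mathcal{C}_{t\le 0},\mathcal{C}_{t\ge 0}$ with $\mathcal{C}_{t\le 0}\subset \mathcal{C}_{t\le 0}[1]$, $\mathcal{C}_{t\ge 0}[1]\subset \mathcal{C}_{t\ge 0}$, $\mathcal{C}_{t\ge 0}[1]\perp \mathcal{C}_{t\le 0}$, and such that every $M$ fits into a distinguished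 triangle $L\to M\to R\to L[1]$ with $L\in \mathcal{C}_{t\ge 0}$, $R\in \mathcal{C}_{t\le 0}[-1]$. Its heart $\underline{Ht}$ is the full subcategory on $\mathcal{C}_{t\le 0}\cap \mathcal{C}_{t\ge 0}$. $\mathcal{C}_{t\le i}=\mathcal{C}_{t\le 0}[i]$, $\mathcal{C}_{t\ge i}=\mathcal{C}_{t\ge 0}[i]$. $t$ is smashing if $\mathcal{C}$ is smashing and $\mathcal{C}_{t\le 0}$ is closed under coproducts; $t$ is cosmashing if $\mathcal{C}$ is cosmashing and $\mathcal{C}_{t\ge 0}$ is closed under products. $t$ restricts to a full triangulated subcategory $\mathcal{D}$ if $(\mathcal{C}_{t\le 0}\cap \operatorname{Obj}\mathcal{D}, \mathcal{C}_{t\ge 0}\cap \operatorname{Obj}\mathcal{D})$ is a $t$-structure on $\mathcal{D}$. $t$ is right adjacent to $w$ if $\mathcal{C}_{t\ge 0}=\mathcal{C}_{w\ge 0}$, and left adjacent to $w$ if $\mathcal{C}_{t\le 0}=\mathcal{C}_{w\le 0}$. A $t$-structure $t$ on a full triangulated subcategory $\mathcal{C}'$ of $\mathcal{C}$ is left orthogonal to $w$ if $\mathcal{C}'_{t\ge 1}\perp \mathcal{C}_{w\le 0}$ and $\mathcal{C}'_{t\le -1}\perp \mathcal{C}_{w\ge 0}$. $\mathcal{C}$ satisfies the Brown representability property if it is smashing and every cohomological functor from $\mathcal{C}$ into $\mathrm{Ab}$ that converts all coproducts into products is representable. $\mathcal{C}$ satisfies the dual Brown representability property if $\mathcal{C}^{op}$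 satisfies the Brown representability property, i.e., $\mathcal{C}$ is cosmashing and every homological functor $\mathcal{C}\to \mathrm{Ab}$ that respects products is corepresentable. A functor $\underline{Hw}^{op}\to\mathrm{Ab}$ respects products if it converts $\underline{Hw}$-coproducts into products. For $\mathcal{C}$ smashing and an infinite cardinal $\alpha$, an object $M$ is $\alpha$-small if for every family $N_i$, $i\in I$, of objects one has $\mathcal{C}(M,\coprod_{i\in I}N_i)=\varinjlim_{J\subset I,\ \#J<\alpha}\mathcal{C}(M,\coprod_{j\in J}N_j)$; $\mathcal{C}^{(\alpha)}$ is the full triangulated subcategory of $\alpha$-small objects. *)

(* Defs.v *)
From HB Require Import structures.
From mathcomp Require Import all_boot all_algebra all_classical.
Set Implicit Arguments.
Unset Strict Implicit.
Unset Printing Implicit Defensive.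
Import GRing.Theory.
Local Open Scope classical_set_scope.
Local Open Scope ring_scope.

Declare Scope cat_scope.
Delimit Scope cat_scope with cat.
Local Open Scope cat_scope.
Reserved Notation "g ∘ f" (at level 40, left associativity).

(* Small sets live in the universe of the carriers of zmodTypes, so that Hom
   groups, the objects of Ab and the index sets of families are all small. *)
Definition small := Type@{Algebra.Zmodule.axioms_.u0}.

(* Categories without smallness assumption on arrows (functor categories need
   not be locally small) and equivalences between them. *)

Record category := Category {
  cob :> Type;
  arr : cob -> cob -> Type;
  aid : forall X, arr X X;
  acomp : forall X Y Z, arr Y Z -> arr X Y -> arr X Z;
  acompA : forall X Y Z T (h : arr Z T) (g : arr Y Z) (f : arr X Y),
    acomp h (acomp g f) = acomp (acomp h g) f;
  acomp1l : forall X Y (f : arr X Y), acomp (aid Y) f = f;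
  acomp1r : forall X Y (f : arr X Y), acomp f (aid X) = f }.

Record functor (A B : category) := Functor {
  fun_ob :> A -> B;
  fun_arr : forall X Y : A, arr X Y -> arr (fun_ob X) (fun_ob Y);
  fun_id : forall X, fun_arr (aid X) = aid (fun_ob X);
  fun_comp : forall (X Y Z : A) (g : arr Y Z) (f : arr X Y),
    fun_arr (acomp g f) = acomp (fun_arr g) (fun_arr f) }.

Definition arr_iso (A : category) (X Y : A) (f : arr X Y) : Prop :=
  exists g : arr Y X, acomp g f = aid X /\ acomp f g = aid Y.

Definition equivalent (A B : category) : Prop :=
  exists (F : functor A B) (G : functor B A)
    (e : forall X : A, arr (G (F X)) X) (d : forall Y : B, arr (F (G Y)) Y),
  [/\ forall X, arr_iso (e X),
      forall Y, arr_iso (d Y),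
      forall (X X' : A) (f : arr X X'),
        acomp f (e X) = acomp (e X') (fun_arr G (fun_arr F f)) &
      forall (Y Y' : B) (f : arr Y Y'),
        acomp f (d Y) = acomp (d Y') (fun_arr F (fun_arr G f))].

Record preadditive := Preadditive {
  obj :> Type;
  hom : obj -> obj -> zmodType;
  idm : forall X, hom X X;
  mcomp : forall X Y Z, hom Y Z -> hom X Y -> hom X Z;
  homA : forall X Y Z T (h : hom Z T) (g : hom Y Z) (f : hom X Y),
    mcomp h (mcomp g f) = mcomp (mcomp h g) f;
  hom1l : forall X Y (f : hom X Y), mcomp (idm Y) f = f;
  hom1r : forall X Y (f : hom X Y), mcomp f (idm X) = f;
  homDl : forall X Y Z (g g' : hom Y Z) (f : hom X Y),
    mcomp (g + g') f = mcomp g f + mcomp g' f;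
  homDr : forall X Y Z (g : hom Y Z) (f f' : hom X Y),
    mcomp g (f + f') = mcomp g f + mcomp g f' }.

Notation "g ∘ f" := (mcomp g f) : cat_scope.

Definition underlying (C : preadditive) : category :=
  @Category C (fun X Y => hom X Y) (@idm C) (@mcomp C)
    (@homA C) (@hom1l C) (@hom1r C).

Definition opposite (C : preadditive) : preadditive :=
  @Preadditive C (fun X Y => hom Y X) (@idm C) (fun X Y Z g f => f ∘ g)
    (fun X Y Z T h g f => esym (homA f g h))
    (fun X Y f => hom1r f) (fun X Y f => hom1l f)
    (fun X Y Z g g' f => homDr f g g') (fun X Y Z g f f' => homDl f f' g).

Definition full_subcat (C : preadditive) (P : C -> Prop) : preadditive :=
  @Preadditive {X : C | P X} (fun X Y => hom (sval X) (sval Y))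
    (fun X => idm (sval X)) (fun X Y Z g f => g ∘ f)
    (fun X Y Z T h g f => homA h g f)
    (fun X Y f => hom1l f) (fun X Y f => hom1r f)
    (fun X Y Z g g' f => homDl g g' f) (fun X Y Z g f f' => homDr g f f').

Section Comp.
Variables (C : preadditive) (X Y Z : C) (g : hom Y Z).

Lemma comp_is_additive : zmod_morphism (@mcomp C X Y Z g).
Proof.
move=> f f'; apply: (addIr (g ∘ f')).
by rewrite -homDr !subrK.
Qed.

HB.instance Definition _ :=
  GRing.isZmodMorphism.Build (hom X Y) (hom X Z) (@mcomp C X Y Z g)
    comp_is_additive.
End Comp.

Section Preadditive.
Variable C : preadditive.

Lemma comp0r (X Y Z : C) (g : hom Y Z) : g ∘ (0 : hom X Y) = 0.
Proof. exact: raddf0. Qed.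

Lemma compBr (X Y Z : C) (g : hom Y Z) (f f' : hom X Y) :
  g ∘ (f - f') = g ∘ f - g ∘ f'.
Proof. exact: raddfB. Qed.

Lemma compBl (X Y Z : C) (g g' : hom Y Z) (f : hom X Y) :
  (g - g') ∘ f = g ∘ f - g' ∘ f.
Proof. by apply: (addIr (g' ∘ f)); rewrite -homDl !subrK. Qed.

Lemma comp0l (X Y Z : C) (f : hom X Y) : (0 : hom Y Z) ∘ f = 0.
Proof. by rewrite -[0](subrr 0) compBl subrr. Qed.

Definition is_iso (X Y : C) (f : hom X Y) : Prop :=
  exists g : hom Y X, g ∘ f = idm X /\ f ∘ g = idm Y.

Definition isomorphic (X Y : C) : Prop := exists f : hom X Y, is_iso f.

Definition is_biproduct (X Y P : C) : Prop :=
  exists (i : hom X P) (j : hom Y P) (p : hom P X) (q : hom P Y),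
  [/\ p ∘ i = idm X, q ∘ j = idm Y, p ∘ j = 0, q ∘ i = 0 &
      i ∘ p + j ∘ q = idm P].

Definition is_product (I : small) (M : I -> C) (P : C)
    (p : forall k, hom P (M k)) : Prop :=
  forall (N : C) (f : forall k, hom N (M k)),
    exists! g : hom N P, forall k, p k ∘ g = f k.

Definition has_products : Prop :=
  forall (I : small) (M : I -> C),
    exists (P : C) (p : forall k, hom P (M k)), is_product p.

Definition closed_under_products (A : C -> Prop) : Prop :=
  forall (I : small) (M : I -> C) (P : C) (p : forall k, hom P (M k)),
    is_product p -> (forall k, A (M k)) -> A P.

Definition closed_under_isos (A : C -> Prop) : Prop :=
  forall X Y, isomorphic X Y -> A X -> A Y.

Definition closed_under_retracts (A : C -> Prop) : Prop :=
  forall (X Y : C) (i : hom X Y) (r : hom Y X), r ∘ i = idm X -> A Y -> A X.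

Definition perp (A B : C -> Prop) : Prop :=
  forall (X Y : C) (f : hom X Y), A X -> B Y -> f = 0.
End Preadditive.

Definition is_coproduct (C : preadditive) (I : small) (M : I -> C) (P : C)
    (i : forall k, hom (M k) P) : Prop :=
  @is_product (opposite C) I M P i.

Definition has_coproducts (C : preadditive) : Prop :=
  has_products (opposite C).

Definition closed_under_coproducts (C : preadditive) (A : C -> Prop) : Prop :=
  @closed_under_products (opposite C) A.

(* Additive functors D -> Ab; the contravariant ones are those on opposite D. *)

Record ab_functor (D : preadditive) := AbFunctor {
  abf_ob :> D -> zmodType;
  fmap : forall X Y : D, hom X Y -> {additive abf_ob X -> abf_ob Y};
  fmap_id : forall X x, fmap (idm X) x = x;
  fmap_comp : forall (X Y Z : D) (g : hom Y Z) (f : hom X Y) x,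
    fmap (g ∘ f) x = fmap g (fmap f x);
  fmapD : forall (X Y : D) (f f' : hom X Y) x,
    fmap (f + f') x = fmap f x + fmap f' x }.
Arguments fmap {D} _ {X Y}.

Record nat_trans (D : preadditive) (F G : ab_functor D) := NatTrans {
  nt :> forall X : D, {additive F X -> G X};
  ntP : forall (X Y : D) (f : hom X Y) x,
    nt Y (fmap F f x) = fmap G f (nt X x) }.

Section NatTrans.
Variable D : preadditive.
Implicit Types F G H K : ab_functor D.

Lemma additive_ext (U V : zmodType) (f g : {additive U -> V}) :
  f =1 g -> f = g.
Proof.
case: f => f [[fP]]; case: g => g [[gP]] /= /funext fg.
by case: _ / fg gP => gP; rewrite (Prop_irrelevance gP fP).
Qed.

Lemma nat_trans_ext F G (a b : nat_trans F G) :
  (forall X, a X =1 b X) -> a = b.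
Proof.
case: a b => [a aP] [b bP] /= ab.
have {}ab : a = b.
  by apply: functional_extensionality_dep => X; apply: additive_ext; exact: ab.
by case: _ / ab bP => bP; rewrite (Prop_irrelevance aP bP).
Qed.

Definition nat_id F : nat_trans F F :=
  @NatTrans D F F (fun X => idfun) (fun X Y f x => erefl).

Lemma nat_comp_subproof F G H (b : nat_trans G H) (a : nat_trans F G)
    (X Y : D) (f : hom X Y) x :
  (b Y \o a Y) (fmap F f x) = fmap H f ((b X \o a X) x).
Proof. by rewrite /= !ntP. Qed.

Definition nat_comp F G H (b : nat_trans G H) (a : nat_trans F G) :
    nat_trans F H :=
  @NatTrans D F H (fun X => b X \o a X) (nat_comp_subproof b a).

Definition nat_iso F G : Prop :=
  exists a : nat_trans F G, forall X, bijective (a X).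

Lemma nat_compA F G H K (c : nat_trans H K) (b : nat_trans G H)
    (a : nat_trans F G) :
  nat_comp c (nat_comp b a) = nat_comp (nat_comp c b) a.
Proof. exact: nat_trans_ext. Qed.

Lemma nat_comp1l F G (a : nat_trans F G) : nat_comp (nat_id G) a = a.
Proof. exact: nat_trans_ext. Qed.

Lemma nat_comp1r F G (a : nat_trans F G) : nat_comp a (nat_id F) = a.
Proof. exact: nat_trans_ext. Qed.

Definition hom_functor (N : D) : ab_functor D :=
  @AbFunctor D (fun X => hom N X)
    (fun X Y f => (mcomp f : {additive hom N X -> hom N Y}))
    (fun X x => hom1l x) (fun X Y Z g f x => esym (homA g f x))
    (fun X Y f f' x => homDl f f' x).

Definition corepresentable F : Prop := exists N : D, nat_iso (hom_functor N) F.

(* On opposite C this says that F sends coproducts of C to products. *)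
Definition respects_products F : Prop :=
  forall (I : small) (M : I -> D) (P : D) (p : forall k, hom P (M k)),
    is_product p ->
    forall y : (forall k, F (M k)),
      exists! x : F P, forall k, fmap F (p k) x = y k.

Definition product_functors : category :=
  let T := {F : ab_functor D | respects_products F} in
  @Category T (fun F G : T => nat_trans (sval F) (sval G))
    (fun F : T => nat_id (sval F))
    (fun (F G H : T) b a => nat_comp b a)
    (fun (F G H K : T) c b a => nat_compA c b a)
    (fun (F G : T) a => nat_comp1l a) (fun (F G : T) a => nat_comp1r a).
End NatTrans.

Definition representable (C : preadditive) (F : ab_functor (opposite C)) :
    Prop :=
  corepresentable F.

(* The shift is an additive autoequivalence, not necessarily invertible on the
   nose. *)

Record triangulated := Triangulated {
  tcat :> preadditive;
  zero_ex : exists Z : tcat, idm Z = 0;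
  biproduct_ex : forall X Y : tcat, exists P, is_biproduct X Y P;
  sh : tcat -> tcat;
  shm : forall X Y : tcat, {additive hom X Y -> hom (sh X) (sh Y)};
  shm_id : forall X, shm X X (idm X) = idm (sh X);
  shm_comp : forall (X Y Z : tcat) (g : hom Y Z) (f : hom X Y),
    shm X Z (g ∘ f) = shm Y Z g ∘ shm X Y f;
  shm_bij : forall X Y, bijective (shm X Y);
  sh_esssurj : forall Y, exists X, isomorphic (sh X) Y;
  dist : forall X Y Z : tcat, hom X Y -> hom Y Z -> hom Z (sh X) -> Prop;
  dist_iso : forall (X Y Z X' Y' Z' : tcat)
      (f : hom X Y) (g : hom Y Z) (h : hom Z (sh X))
      (f' : hom X' Y') (g' : hom Y' Z') (h' : hom Z' (sh X'))
      (a : hom X X') (b : hom Y Y') (c : hom Z Z'),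
    is_iso a -> is_iso b -> is_iso c ->
    b ∘ f = f' ∘ a -> c ∘ g = g' ∘ b -> shm X X' a ∘ h = h' ∘ c ->
    dist f g h -> dist f' g' h';
  dist_id : forall X Z : tcat, idm Z = 0 ->
    dist (idm X) (0 : hom X Z) (0 : hom Z (sh X));
  dist_cone : forall (X Y : tcat) (f : hom X Y),
    exists (Z : tcat) (g : hom Y Z) (h : hom Z (sh X)), dist f g h;
  dist_rot : forall (X Y Z : tcat)
      (f : hom X Y) (g : hom Y Z) (h : hom Z (sh X)),
    dist f g h <-> dist g h (- shm X Y f);
  dist_fill : forall (X Y Z X' Y' Z' : tcat)
      (f : hom X Y) (g : hom Y Z) (h : hom Z (sh X))
      (f' : hom X' Y') (g' : hom Y' Z') (h' : hom Z' (sh X'))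
      (a : hom X X') (b : hom Y Y'),
    dist f g h -> dist f' g' h' -> b ∘ f = f' ∘ a ->
    exists c : hom Z Z', c ∘ g = g' ∘ b /\ shm X X' a ∘ h = h' ∘ c;
  dist_oct : forall (X Y Z U V W : tcat) (f : hom X Y) (g : hom Y Z)
      (a : hom Y U) (a' : hom U (sh X))
      (b : hom Z V) (b' : hom V (sh Y))
      (c : hom Z W) (c' : hom W (sh X)),
    dist f a a' -> dist g b b' -> dist (g ∘ f) c c' ->
    exists (u : hom U W) (v : hom W V),
      [/\ dist u v (shm Y U a ∘ b'), u ∘ a = c ∘ g, c' ∘ u = a',
          v ∘ c = b & b' ∘ v = shm X Y f ∘ c'] }.
Arguments shm {_ X Y}.
Arguments shm_bij {_}.

Notation smashing C := (has_coproducts C).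
Notation cosmashing C := (has_products C).

(* A[1] and A[-1], closed under isomorphisms as the shift is only an
   equivalence. *)
Definition shift (C : triangulated) (A : C -> Prop) (Y : C) : Prop :=
  exists2 X, A X & isomorphic (sh X) Y.
Definition unshift (C : triangulated) (A : C -> Prop) (Y : C) : Prop :=
  exists2 X, A X & isomorphic X (sh Y).

(* Homological and cohomological functors; long exactness follows from
   exactness in the middle term by rotation. *)

Definition homological (C : triangulated) (F : ab_functor C) : Prop :=
  forall (X Y Z : C) (f : hom X Y) (g : hom Y Z) (h : hom Z (sh X)),
    dist f g h ->
    forall y : F Y, fmap F g y = 0 <-> exists x : F X, fmap F f x = y.

Definition cohomological (C : triangulated) (F : ab_functor (opposite C)) :
    Prop :=
  forall (X Y Z : C) (f : hom X Y) (g : hom Y Z) (h : hom Z (sh X)),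
    dist f g h ->
    forall y : F Y, @fmap (opposite C) F Y X f y = 0 <->
      exists z : F Z, @fmap (opposite C) F Z Y g z = y.

Definition brown (C : triangulated) : Prop :=
  smashing C /\ forall F : ab_functor (opposite C),
    cohomological F -> respects_products F -> representable F.

Definition dual_brown (C : triangulated) : Prop :=
  cosmashing C /\ forall F : ab_functor C,
    homological F -> respects_products F -> corepresentable F.

Record weight_structure (C : triangulated) := WeightStructure {
  w_le : C -> Prop;
  w_ge : C -> Prop;
  w_le_retract : closed_under_retracts w_le;
  w_ge_retract : closed_under_retracts w_ge;
  w_le_shift : forall X, w_le X -> shift w_le X;
  w_ge_shift : forall X, shift w_ge X -> w_ge X;
  w_perp : perp w_le (shift w_ge);
  w_decomp : forall M : C, exists (L R : C) (f : hom L M) (g : hom M R)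
    (h : hom R (sh L)), [/\ w_le L, shift w_ge R & dist f g h] }.

Definition w_heart (C : triangulated) (w : weight_structure C) : preadditive :=
  full_subcat (fun X => w_le w X /\ w_ge w X).

Definition w_smashing (C : triangulated) (w : weight_structure C) : Prop :=
  smashing C /\ closed_under_coproducts (w_ge w).

Definition w_cosmashing (C : triangulated) (w : weight_structure C) : Prop :=
  cosmashing C /\ closed_under_products (w_le w).

(* Homological convention. *)
Record t_structure (C : triangulated) := TStructure {
  t_le : C -> Prop;
  t_ge : C -> Prop;
  t_le_iso : closed_under_isos t_le;
  t_ge_iso : closed_under_isos t_ge;
  t_le_shift : forall X, t_le X -> shift t_le X;
  t_ge_shift : forall X, shift t_ge X -> t_ge X;
  t_perp : perp (shift t_ge) t_le;
  t_decomp : forall M : C, exists (L R : C) (f : hom L M) (g : hom M R)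
    (h : hom R (sh L)), [/\ t_ge L, unshift t_le R & dist f g h] }.

Definition t_heart (C : triangulated) (t : t_structure C) : preadditive :=
  full_subcat (fun X => t_le t X /\ t_ge t X).

Definition t_smashing (C : triangulated) (t : t_structure C) : Prop :=
  smashing C /\ closed_under_coproducts (t_le t).

Definition t_cosmashing (C : triangulated) (t : t_structure C) : Prop :=
  cosmashing C /\ closed_under_products (t_ge t).

Definition right_adjacent (C : triangulated) (t : t_structure C)
    (w : weight_structure C) : Prop :=
  forall X, t_ge t X <-> w_ge w X.

Definition left_adjacent (C : triangulated) (t : t_structure C)
    (w : weight_structure C) : Prop :=
  forall X, t_le t X <-> w_le w X.

(* Full triangulated subcategories, given by (strict) classes of objects. *)

Record triangulated_class (C : triangulated) (D : C -> Prop) : Prop :=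
    TriangulatedClass {
  tclass_iso : closed_under_isos D;
  tclass_zero : exists2 Z : C, idm Z = 0 & D Z;
  tclass_sh : forall X, D X <-> D (sh X);
  tclass_cone : forall (X Y Z : C) (f : hom X Y) (g : hom Y Z)
    (h : hom Z (sh X)), dist f g h -> D X -> D Y -> D Z }.

Section Subcategory.
Variable C : triangulated.

Lemma dist_comp0 (X Y Z : C) (f : hom X Y) (g : hom Y Z) (h : hom Z (sh X)) :
  dist f g h -> g ∘ f = 0.
Proof.
move=> fgh; have [O O0] := zero_ex C.
have [c [cg _]] := dist_fill (dist_id X O0) fgh (erefl (f ∘ idm X)).
by rewrite -cg comp0r.
Qed.

Lemma dist_0id (O X : C) : idm O = 0 ->
  dist (0 : hom O X) (idm X) (0 : hom X (sh O)).
Proof.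
move=> O0; apply/dist_rot; rewrite raddf0 oppr0.
by apply: dist_id; rewrite -shm_id O0 raddf0.
Qed.

Lemma split_biproduct (X Y T Z : C) (i : hom X Z) (h : hom Z (sh T)) :
  dist (0 : hom T X) i h -> isomorphic (sh T) Y -> is_biproduct X Y Z.
Proof.
move=> ih [e [e' [e'e ee']]]; have [O O0] := zero_ex C.
have ih1 := (dist_rot _ _ _).1 ih.
have hi : h ∘ i = 0 by apply: dist_comp0 ih1.
have [r [ri _]] := dist_fill (a := 0 : hom T O) (b := idm X) ih
  (dist_0id X O0) (etrans (comp0r _ _) (esym (comp0r _ _))).
rewrite !hom1l in ri.
have [c [_]] := dist_fill (a := idm (sh T)) (b := 0 : hom O (sh X))
  ((dist_rot _ _ _).1 (dist_id (sh T) O0))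
  ((dist_rot _ _ _).1 ((dist_rot _ _ _).1 ih1))
  ltac:(by rewrite comp0l raddf0 oppr0 comp0l).
rewrite !shm_id hom1l => hc.
have [s cE] : exists s : hom (sh T) Z, c = shm s.
  by have [k _ kK] := shm_bij (sh T) Z; exists (k c).
have hs : h ∘ s = idm (sh T).
  apply: (bij_inj (shm_bij (sh T) (sh T))); rewrite shm_comp shm_id.
  apply: oppr_inj; rewrite hc cE -[- shm h]sub0r compBl comp0l.
  by rewrite sub0r.
pose r' := r - r ∘ s ∘ h.
have r'i : r' ∘ i = idm X by rewrite compBl ri -homA hi comp0r subr0.
have r's : r' ∘ s = 0 by rewrite compBl -!homA hs hom1r subrr.
pose d := idm Z - i ∘ r' - s ∘ h.
have di : d ∘ i = 0.
  by rewrite !compBl hom1l -!homA r'i hi comp0r hom1r subrr subr0.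
have ds : d ∘ s = 0.
  by rewrite !compBl hom1l -!homA r's hs comp0r hom1r subr0 subrr.
have [k [kh _]] := dist_fill (a := 0 : hom X O) (b := d) ih1
  (dist_0id Z O0) (etrans di (esym (comp0r _ _))).
rewrite hom1l in kh.
have d0 : d = 0.
  have k0 : k = 0 by rewrite -(hom1r k) -hs homA kh ds.
  by rewrite -kh k0 comp0l.
exists i, (s ∘ e'), r', (e ∘ h); split=> //.
- by rewrite -homA (homA h) hs hom1l.
- by rewrite homA r's comp0l.
- by rewrite -homA hi comp0r.
- rewrite -homA (homA e') e'e hom1l; apply: esym.
  by apply/eqP; rewrite -subr_eq0 opprD addrA; apply/eqP.
Qed.

Variables (D : C -> Prop) (DP : triangulated_class D).
Local Notation S := (full_subcat D).

Lemma sub_zero_ex : exists Z : S, idm Z = 0.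
Proof. by have [Z Z0 DZ] := tclass_zero DP; exists (exist _ Z DZ). Qed.

Lemma sub_unshift (Y : C) : D Y -> exists2 X, D X & isomorphic (sh X) Y.
Proof.
move=> DY; have [X XY] := sh_esssurj Y; exists X => //.
apply/(tclass_sh DP); apply: tclass_iso DY => //.
by have [e [e' [? ?]]] := XY; exists e', e.
Qed.

Lemma sub_biproduct_ex (X Y : S) : exists P, is_biproduct X Y P.
Proof.
have [T DT TY] := sub_unshift (svalP Y).
have [Z [i [h ih]]] := dist_cone (0 : hom T (sval X)).
have DZ : D Z by apply: (tclass_cone DP ih) => //; exact: (svalP X).
by exists (exist _ Z DZ : S); exact: split_biproduct ih TY.
Qed.

Definition sub_sh (X : S) : S :=
  exist _ (sh (sval X)) ((tclass_sh DP (sval X)).1 (svalP X)).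

Lemma sub_sh_esssurj (Y : S) : exists X : S, isomorphic (sub_sh X) Y.
Proof.
by have [X DX XY] := sub_unshift (svalP Y); exists (exist _ X DX : S).
Qed.

Lemma sub_dist_cone (X Y : S) (f : hom X Y) :
  exists (Z : S) (g : hom Y Z) (h : hom Z (sub_sh X)),
    @dist C (sval X) (sval Y) (sval Z) f g h.
Proof.
have [Z [g [h fgh]]] := @dist_cone C (sval X) (sval Y) f.
have DZ : D Z := tclass_cone DP fgh (svalP X) (svalP Y).
by exists (exist _ Z DZ : S), g, h.
Qed.

Definition sub_triangulated : triangulated :=
  @Triangulated S sub_zero_ex sub_biproduct_ex sub_sh
    (fun X Y => @shm C (sval X) (sval Y))
    (fun X => shm_id (sval X))
    (fun X Y Z g f => @shm_comp C (sval X) (sval Y) (sval Z) g f)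
    (fun X Y => shm_bij (sval X) (sval Y))
    sub_sh_esssurj
    (fun X Y Z f g h => @dist C (sval X) (sval Y) (sval Z) f g h)
    (fun X Y Z X' Y' Z' => @dist_iso C (sval X) (sval Y) (sval Z)
                             (sval X') (sval Y') (sval Z'))
    (fun X Z => @dist_id C (sval X) (sval Z))
    sub_dist_cone
    (fun X Y Z => @dist_rot C (sval X) (sval Y) (sval Z))
    (fun X Y Z X' Y' Z' => @dist_fill C (sval X) (sval Y) (sval Z)
                             (sval X') (sval Y') (sval Z'))
    (fun X Y Z U V W => @dist_oct C (sval X) (sval Y) (sval Z)
                          (sval U) (sval V) (sval W)).
End Subcategory.

Section SubStructures.
Variables (C : triangulated) (D : C -> Prop) (DP : triangulated_class D).
Local Notation S := (sub_triangulated DP).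

Definition is_restriction (t : t_structure C) (t' : t_structure S) : Prop :=
  forall X : S, (t_le t' X <-> t_le t (sval X)) /\
                (t_ge t' X <-> t_ge t (sval X)).

Definition left_orthogonal (t' : t_structure S) (w : weight_structure C) :
    Prop :=
  forall (X : S) (Y : C) (f : hom (sval X) Y),
    (shift (t_ge t') X -> w_le w Y -> f = 0) /\
    (unshift (t_le t') X -> w_ge w Y -> f = 0).
End SubStructures.

Local Open Scope card_scope.

Definition card_lt (I alpha : Type) (J : set I) : bool :=
  (J #<= [set: alpha]) && ~~ ([set: alpha] #<= J).

(* The infinite cardinal alpha is given as the cardinal of a small type. The
   coproduct over J of the family N is P J, with injections i_ J; u is a cocone
   over the directed poset of subsets J of I with #J < alpha, ordered by
   inclusion, t is the canonical morphism P J -> P J' and s the canonical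
   morphism P J -> Q: the conclusion is the universal property of the colimit
   in Ab. *)
Definition alpha_small (C : preadditive) (alpha : small) (M : C) : Prop :=
  forall (I : small) (N : I -> C)
    (P : {J : set I | card_lt alpha J} -> C)
    (i_ : forall J (k : {k : I | sval J k}), hom (N (sval k)) (P J))
    (Q : C) (iQ : forall k, hom (N k) Q),
  (forall J, @is_coproduct C {k : I | sval J k} (fun k => N (sval k)) (P J)
               (i_ J)) ->
  is_coproduct iQ ->
  forall (A : zmodType) (u : forall J, {additive hom M (P J) -> A}),
  (forall J J' (JJ' : sval J `<=` sval J') (t : hom (P J) (P J')),
     (forall k, t ∘ i_ J k = i_ J' (exist _ (sval k) (JJ' _ (svalP k)))) ->
     forall f, u J' (t ∘ f) = u J f) ->
  let factors (v : {additive hom M Q -> A}) :=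
    forall J (s : hom (P J) Q), (forall k, s ∘ i_ J k = iQ (sval k)) ->
    forall f, v (s ∘ f) = u J f in
  exists2 v, factors v & forall v', factors v' -> v' =1 v.

(* Main.v *)
(* The truncation and heart functors are cohomological functors built from the
   weight structure, and Brown representability turns them into objects.

   Write S for the class of objects of weight at most 0, and consider covariant
   functors (part I is obtained from the opposite category).  A functor K on S
   extends to C by H(X) = coker (K V -> K L), where L -> X is a weight
   truncation, hence an S-precover of X, and V -> L is a weak kernel in S of
   L -> X.  If K is exact on triangles in S, then H is homological; it vanishes
   on objects of weight at least 1 and restricts to K on S; if w is cosmashing
   and K preserves products, so does H, and H is corepresented by an object
   of S.
   - For K = C(M, -) the corepresenting object is the universal morphism from M
     to S; its fiber is left orthogonal to S, which gives the t-structure.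
   - For F on the heart of w take K(Y) = ker (F P -> F P'), where Y -> P -> P' is
     the beginning of a coresolution of Y by objects of the heart of w.  The
     corepresenting object lies in the heart of t and induces F.

   For part II.2, a morphism M -> Q to a coproduct is supported on J if it
   factors through the subcoproduct indexed by J; M is alpha-small iff each such
   morphism is supported on a set of cardinality less than alpha. *)
From HB Require Import structures.
From mathcomp Require Import all_boot all_algebra all_classical.
Require Import Defs.
Set Implicit Arguments.
Unset Strict Implicit.
Unset Printing Implicit Defensive.
Import GRing.Theory.
Local Open Scope classical_set_scope.
Local Open Scope ring_scope.
Local Open Scope cat_scope.

(** * Subgroups, quotients and functors given by relations *)

(** C(M, -) is already corepresented by M; to obtain an object of S it is replaced by a functor that
    agrees with it on S and kills weights at least 1. This is what the left Kan extension H of K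
    from S does: C(-, V) -> C(-, L) -> C(-, X) -> 0 is exact on S, so H(X) is the cokernel of K V ->
    K L. Weight truncations are not functorial, but two lifts of a morphism to the precovers differ
    by a morphism killed in X, which factors through V; hence H is a functor.

    The universal morphism M -> A to S alone says nothing about its fiber B. Orthogonality of B to S
    comes from the closure of S under extensions: a morphism B -> X gives an extension of A by X,
    which lies in S and splits by universality.

    On the heart of w the construction runs twice in opposite directions: K is a kernel over a
    coresolution, H a cokernel over a resolution.

    All infinite cardinals, singular ones included, are covered because supports are only combined
    by unions of two sets, and alpha + alpha = alpha keeps such unions below alpha. *)

Lemma choice_family (I : Type) (T : I -> Type) (P : forall k, T k -> Prop) :
  (forall k, exists x, P k x) -> exists f : forall k, T k, forall k, P k (f k).
Proof.
by move=> ex; exists (fun k => sval (cid (ex k))) => k; exact: (svalP (cid (ex k))).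
Qed.

Section Subgroups.
Local Open Scope quotient_scope.
Variables (V : zmodType) (N : V -> Prop).
Hypotheses (N0 : N 0) (NB : forall x y, N x -> N y -> N (x - y)).

Definition subgroup_pred : {pred V} := fun x => `[< N x >].

Lemma subgroup_pred_closed : zmod_closed subgroup_pred.
Proof.
by split=> [|x y /asboolP Nx /asboolP Ny]; apply/asboolP; [exact: N0|exact: NB].
Qed.

HB.instance Definition _ :=
  GRing.isZmodClosed.Build V subgroup_pred subgroup_pred_closed.

Record subgroup_type := Subgroup {
  subgroup_val : V;
  _ : subgroup_val \in subgroup_pred }.

HB.instance Definition _ := [isSub for subgroup_val].
HB.instance Definition _ := [Choice of subgroup_type by <:].
HB.instance Definition _ := [SubChoice_isSubZmodule of subgroup_type by <:].

Lemma subgroup_ex : exists (S : zmodType) (i : {additive S -> V}),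
  injective i /\ forall x, N x <-> exists s, i s = x.
Proof.
exists subgroup_type, (\val : {additive subgroup_type -> V}).
split=> [|x]; first exact: val_inj.
split=> [Nx|[s <-]]; last by case: s => y /= /asboolP.
have Nx' : x \in subgroup_pred by apply/asboolP.
by exists (Subgroup Nx').
Qed.

Lemma quotient_ex : exists (Q : zmodType) (q : {additive V -> Q}),
  (forall y, exists x, q x = y) /\ forall x, q x = 0 <-> N x.
Proof.
pose Q := Quotient.quot subgroup_pred.
exists Q, (\pi_Q : {additive V -> Q}); split=> [y|x].
  by exists (repr y); exact: (reprK y).
have -> : (\pi_Q x = 0) <-> ((x - 0) \in subgroup_pred).
  rewrite Quotient.idealrBE -[0 : Q](raddf0 (\pi_Q : {additive V -> Q})).
  by split=> [->|/eqP].
rewrite subr0; split=> [/asboolP//|Nx]; exact/asboolP.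
Qed.
End Subgroups.

Lemma additive_inverse (U V : zmodType) (f : {additive U -> V}) : bijective f ->
  exists2 g : {additive V -> U}, cancel f g & cancel g f.
Proof.
move=> [g fg gf].
have gB : zmod_morphism g by move=> x y; apply: (can_inj fg); rewrite raddfB !gf.
by exists (HB.pack_for {additive V -> U} g (GRing.isZmodMorphism.Build _ _ g gB)).
Qed.

Lemma nat_iso_inverse (D : preadditive) (F G : ab_functor D) (a : nat_trans F G) :
  (forall X, bijective (a X)) ->
  exists b : nat_trans G F, nat_comp b a = nat_id F /\ nat_comp a b = nat_id G.
Proof.
move=> abij.
pose b X := s2val (cid2 (additive_inverse (abij X))).
have ab X : cancel (a X) (b X) := s2valP (cid2 (additive_inverse (abij X))).
have ba X : cancel (b X) (a X) := s2valP' (cid2 (additive_inverse (abij X))).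
unshelve eexists (@NatTrans D G F b _) => [X Y f x|].
  by apply: (can_inj (ab Y)); rewrite ba ntP ba.
by split; apply: nat_trans_ext => X x; [exact: ab|exact: ba].
Qed.

(* The values of the functors below are only determined up to a choice of
   truncations; a functional relation hides these choices. *)
Section FunctorOfRelation.
Variables (D : preadditive) (V : D -> zmodType).
Variable act : forall X Y : D, hom X Y -> V X -> V Y -> Prop.
Hypothesis act_total : forall X Y (f : hom X Y) x, exists y, act f x y.
Hypothesis act_unique : forall X Y (f : hom X Y) x y y',
  act f x y -> act f x y' -> y = y'.
Hypothesis act_sub : forall X Y (f : hom X Y) x y x' y',
  act f x y -> act f x' y' -> act f (x - x') (y - y').
Hypothesis act_id : forall X x, act (idm X) x x.
Hypothesis act_comp : forall X Y Z (g : hom Y Z) (f : hom X Y) x y z,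
  act f x y -> act g y z -> act (g ∘ f) x z.
Hypothesis act_add : forall X Y (f f' : hom X Y) x y y',
  act f x y -> act f' x y' -> act (f + f') x (y + y').

(** [F X] is [V X] itself; the identities [i] and [j] are exported because the existential hides
    this equality of groups. *)
Lemma functor_of_relation : exists F : ab_functor D,
  exists (i : forall X, {additive V X -> F X})
    (j : forall X, {additive F X -> V X}),
    [/\ forall X, cancel (i X) (j X), forall X, cancel (j X) (i X) &
    forall X Y (f : hom X Y) x y, act f x y -> fmap F f (i X x) = i Y y].
Proof.
have [m mP] : exists m : forall X Y, hom X Y -> {additive V X -> V Y},
    forall X Y (f : hom X Y) x, act f x (m X Y f x).
  pose m0 X Y f x := sval (cid (@act_total X Y f x)).
  have m0P X Y f x : act f x (m0 X Y f x) by rewrite /m0; case: cid.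
  have m0B X Y f : zmod_morphism (m0 X Y f).
    by move=> x y; apply: act_unique; [exact: m0P|exact: act_sub].
  exists (fun X Y f => HB.pack_for {additive V X -> V Y} (m0 X Y f)
    (GRing.isZmodMorphism.Build _ _ (m0 X Y f) (m0B X Y f))).
  exact: m0P.
have mE X Y (f : hom X Y) x y : act f x y -> m X Y f x = y.
  exact: act_unique.
unshelve eexists (@AbFunctor D V m _ _ _).
- by move=> X x; apply: mE.
- by move=> X Y Z g f x; apply: mE; apply: act_comp (mP _ _ _ _).
- by move=> X Y f f' x; apply: mE; apply: act_add.
exists (fun X => idfun : {additive V X -> V X}).
exists (fun X => idfun : {additive V X -> V X}).
by split=> // X Y f x y /mE.
Qed.
End FunctorOfRelation.

(** * Products, full subcategories and abstract triangles with weights *)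

Section Products.
Variable D : preadditive.

Lemma product_lift (I : small) (M : I -> D) (P : D) (p : forall k, hom P (M k)) :
  is_product p -> forall (N : D) (f : forall k, hom N (M k)),
  exists g : hom N P, forall k, p k ∘ g = f k.
Proof. by move=> pP N f; have [g [gP _]] := pP N f; exists g. Qed.

Lemma product_ext (I : small) (M : I -> D) (P : D) (p : forall k, hom P (M k)) :
  is_product p -> forall (N : D) (g g' : hom N P),
  (forall k, p k ∘ g = p k ∘ g') -> g = g'.
Proof.
move=> pP N g g' gg'; have [u [_ uU]] := pP N (fun k => p k ∘ g').
by rewrite -(uU _ gg') (uU g').
Qed.

Lemma product_unique (I : small) (M : I -> D) (P Q : D)
    (p : forall k, hom P (M k)) (q : forall k, hom Q (M k)) :
  is_product p -> is_product q ->
  exists (f : hom P Q) (g : hom Q P), [/\ g ∘ f = idm P, f ∘ g = idm Q,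
    forall k, q k ∘ f = p k & forall k, p k ∘ g = q k].
Proof.
move=> pP qP; have [f fP] := product_lift qP p; have [g gP] := product_lift pP q.
exists f, g; split=> //.
- by apply: (product_ext pP) => k; rewrite homA gP fP hom1r.
- by apply: (product_ext qP) => k; rewrite homA fP gP hom1r.
Qed.

Lemma compNr (X Y Z : D) (g : hom Y Z) (f : hom X Y) : g ∘ (- f) = - (g ∘ f).
Proof. exact: raddfN. Qed.

Lemma compNl (X Y Z : D) (g : hom Y Z) (f : hom X Y) : (- g) ∘ f = - (g ∘ f).
Proof. by rewrite -[- g]sub0r compBl comp0l sub0r. Qed.

Lemma fmapB (F : ab_functor D) (X Y : D) (f f' : hom X Y) x :
  fmap F (f - f') x = fmap F f x - fmap F f' x.
Proof. by apply: (addIr (fmap F f' x)); rewrite -fmapD !subrK. Qed.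

Lemma fmap0 (F : ab_functor D) (X Y : D) x : fmap F (0 : hom X Y) x = 0.
Proof. by rewrite -[0 : hom X Y](subrr 0) fmapB subrr. Qed.
End Products.

Section FullSubcategory.
Variables (D : preadditive) (P : D -> Prop).
Local Notation S := (full_subcat P).

Lemma full_subcat_product (I : small) (M : I -> S) (Q : S)
    (p : forall k, hom Q (M k)) :
  @is_product D I (fun k => sval (M k)) (sval Q) p -> is_product p.
Proof. by move=> pP N f; exact: pP. Qed.

(** The product of the family in [D] lies in [P], so it is also a product in the subcategory and the
    given one is isomorphic to it. *)
Lemma full_subcat_product_conv (I : small) (M : I -> S) (Q : S)
    (p : forall k, hom Q (M k)) :
  has_products D -> closed_under_products P ->
  is_product p -> @is_product D I (fun k => sval (M k)) (sval Q) p.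
Proof.
move=> hP clP pP.
have [R [r rP]] := hP I (fun k => sval (M k)).
have PR : P R by apply: clP rP _ => k; exact: svalP.
have [f [g [gf fg fE gE]]] :=
  product_unique pP (@full_subcat_product I M (exist _ R PR : S) r rP).
move=> N h; have [u uP] := product_lift rP h.
exists (mcomp (g : @hom D R (sval Q)) u); split.
  by move=> k; rewrite homA (gE k : @mcomp D _ _ _ (p k) g = r k) uP.
move=> v vP; suff -> : u = mcomp (f : @hom D (sval Q) R) v.
  by rewrite homA (gf : @mcomp D _ _ _ g f = idm (sval Q)) hom1l.
apply: (product_ext rP) => k.
by rewrite uP homA (fE k : @mcomp D _ _ _ (r k) f = p k) vP.
Qed.

Definition ab_restrict (F : ab_functor D) : ab_functor S :=
  @AbFunctor S (fun X => F (sval X)) (fun X Y f => @fmap D F _ _ f)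
    (fun X x => @fmap_id D F (sval X) x) (fun X Y Z g f x => @fmap_comp D F _ _ _ g f x)
    (fun X Y f f' x => @fmapD D F _ _ f f' x).

(** The arrow is typed in [D], so that composites formed in [D] can be rewritten without casting
    them to the subcategory. *)
Definition sub_fmap (F : ab_functor S) (X Y : S) (f : @hom D (sval X) (sval Y)) :
  {additive F X -> F Y} := @fmap S F X Y f.

(* Products are computed in D, not in the subcategory. *)
Definition preserves_products (F : ab_functor S) : Prop :=
  forall (I : small) (M : I -> S) (Q : S)
    (p : forall k, @hom D (sval Q) (sval (M k))),
    @is_product D I (fun k => sval (M k)) (sval Q) p ->
    forall y : (forall k, F (M k)),
      exists! x : F Q, forall k, sub_fmap F (p k) x = y k.

Section SubFmap.
Variable F : ab_functor S.

Lemma sub_fmap_id (X : S) x :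
  sub_fmap F (idm (sval X) : hom (sval X) (sval X)) x = x.
Proof. exact: (@fmap_id S F). Qed.

Lemma sub_fmap_comp (X Y Z : S) (g : hom (sval Y) (sval Z))
    (f : hom (sval X) (sval Y)) (x : F X) :
  sub_fmap F (X := X) (Y := Z) (g ∘ f) x = sub_fmap F g (sub_fmap F f x).
Proof. exact: (@fmap_comp S F X Y Z g f). Qed.

Lemma sub_fmapD (X Y : S) (f f' : hom (sval X) (sval Y)) (x : F X) :
  sub_fmap F (f + f') x = sub_fmap F f x + sub_fmap F f' x.
Proof. exact: (@fmapD S F X Y f f'). Qed.

Lemma sub_fmapB (X Y : S) (f f' : hom (sval X) (sval Y)) (x : F X) :
  sub_fmap F (f - f') x = sub_fmap F f x - sub_fmap F f' x.
Proof. exact: (@fmapB S F X Y f f'). Qed.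

Lemma sub_fmap0 (X Y : S) (x : F X) :
  sub_fmap F (0 : hom (sval X) (sval Y)) x = 0.
Proof. exact: (@fmap0 S F X Y). Qed.

Lemma respects_preserves_products : respects_products F -> preserves_products F.
Proof.
by move=> Fprod I M Q p pP y; exact: (Fprod I M Q p (full_subcat_product pP)).
Qed.
End SubFmap.

End FullSubcategory.

(* The diagrams A -> B -> X -> Y stand for exact triangles with Y isomorphic
   to the shift of A.  The shift itself does not occur, so that triangulated
   categories and their opposites are instances alike. *)
Record triangulation (D : preadditive) := Triangulation {
  tri : forall A B X Y : D, hom A B -> hom B X -> hom X Y -> Prop;
  tri_biproduct : forall X Y : D, exists P, is_biproduct X Y P;
  tri_comp0 : forall (A B X Y : D) (f : hom A B) (g : hom B X) (h : hom X Y),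
    tri f g h -> g ∘ f = 0;
  tri_desc : forall (A B X Y : D) (f : hom A B) (g : hom B X) (h : hom X Y),
    tri f g h -> forall (T : D) (k : hom B T), k ∘ f = 0 ->
    exists k' : hom X T, k = k' ∘ g;
  tri_lift : forall (A B X Y : D) (f : hom A B) (g : hom B X) (h : hom X Y),
    tri f g h -> forall (T : D) (k : hom T B), g ∘ k = 0 ->
    exists k' : hom T A, k = f ∘ k';
  tri_cone : forall (A B : D) (f : hom A B),
    exists (X Y : D) (g : hom B X) (h : hom X Y), tri f g h;
  tri_rot : forall (A B X Y : D) (f : hom A B) (g : hom B X) (h : hom X Y),
    tri f g h -> exists (Z : D) (k : hom Y Z), tri g h k;
  tri_unrot : forall (A B X Y : D) (f : hom A B) (g : hom B X) (h : hom X Y),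
    tri f g h -> exists (Z : D) (k : hom Z A), tri k f g;
  (* In a triangulated category y is the shift of x ∘ z, up to A = Z[1]. *)
  tri_shift : forall (Z B M A : D) (z : hom Z B) (b : hom B M) (a : hom M A),
    tri z b a -> forall (X : D) (x : hom B X),
    exists (U Y : D) (j : hom X U) (i : hom U A) (y : hom A Y),
      [/\ tri j i y, y ∘ a = 0 & y = 0 -> x ∘ z = 0] }.

(* Weights at most 0, at most -1, at least 0 and at least 1. *)
Record weights (D : preadditive) (T : triangulation D) := Weights {
  le0 : D -> Prop;
  lem1 : D -> Prop;
  ge0 : D -> Prop;
  ge1 : D -> Prop;
  le0P : forall X, le0 X <-> forall Y, ge1 Y -> forall f : hom X Y, f = 0;
  ge1P : forall Y, ge1 Y <-> forall X, le0 X -> forall f : hom X Y, f = 0;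
  lem1P : forall X, lem1 X <-> forall Y, ge0 Y -> forall f : hom X Y, f = 0;
  ge0P : forall Y, ge0 Y <-> forall X, lem1 X -> forall f : hom X Y, f = 0;
  lem1_le0 : forall X, lem1 X -> le0 X;
  weights_decomp0 : forall M, exists (L R Y : D) (f : hom L M) (g : hom M R)
    (h : hom R Y), [/\ le0 L, ge1 R & tri T f g h];
  weights_decompm1 : forall M, exists (L R Y : D) (f : hom L M) (g : hom M R)
    (h : hom R Y), [/\ lem1 L, ge0 R & tri T f g h];
  weights_shift_ge : forall (A B X Y : D) (f : hom A B) (g : hom B X)
    (h : hom X Y), tri T f g h -> ge0 A <-> ge1 Y;
  weights_shift_le : forall (A B X Y : D) (f : hom A B) (g : hom B X)
    (h : hom X Y), tri T f g h -> lem1 A <-> le0 Y }.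

(** * Left extensions of functors on objects of weight at most 0 *)

Section Weights.
Variables (D : preadditive) (T : triangulation D) (W : weights T).

Lemma le0_extension (A B X Y : D) (f : hom A B) (g : hom B X) (h : hom X Y) :
  tri T f g h -> le0 W A -> le0 W X -> le0 W B.
Proof.
move=> fgh /(le0P W) A0 /(le0P W) X0; apply/(le0P W) => Z Z1 k.
have [k' ->] := tri_desc fgh (A0 _ Z1 (k ∘ f)).
by rewrite (X0 _ Z1 k') comp0l.
Qed.

(** [A] is an extension of [B] by the desuspension of [X], which has weight at most -1. *)
Lemma le0_fiber (A B X Y : D) (f : hom A B) (g : hom B X) (h : hom X Y) :
  tri T f g h -> le0 W B -> le0 W X -> le0 W A.
Proof.
move=> fgh B0 X0; have [Z [k kfg]] := tri_unrot fgh.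
apply: (le0_extension kfg) => //; apply/lem1_le0.
by apply/(weights_shift_le W kfg).
Qed.

Lemma le0_biproduct (X Y P : D) : is_biproduct X Y P ->
  le0 W X -> le0 W Y -> le0 W P.
Proof.
move=> [i [j [p [q [_ _ _ _ ipjq]]]]] /(le0P W) X0 /(le0P W) Y0.
apply/(le0P W) => Z Z1 k; rewrite -(hom1r k) -ipjq homDr !homA.
by rewrite (X0 _ Z1 (k ∘ i)) (Y0 _ Z1 (k ∘ j)) !comp0l addr0.
Qed.

Lemma tri_fiber (B X : D) (g : hom B X) :
  exists (A Y : D) (f : hom A B) (h : hom X Y), tri T f g h.
Proof.
have [Y [Z [h [k ghk]]]] := tri_cone T g.
by have [A [f fgh]] := tri_unrot ghk; exists A, Y, f, h.
Qed.

Lemma tri_comp0' (A B X Y : D) (f : hom A B) (g : hom B X) (h : hom X Y) :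
  tri T f g h -> h ∘ g = 0.
Proof. by move=> fgh; have [Z [k /tri_comp0]] := tri_rot fgh. Qed.

Lemma tri_desc' (A B X Y : D) (f : hom A B) (g : hom B X) (h : hom X Y) :
  tri T f g h -> forall (Z : D) (k : hom X Z), k ∘ g = 0 ->
  exists k' : hom Y Z, k = k' ∘ h.
Proof. by move=> fgh; have [Z [k ghk]] := tri_rot fgh; apply: tri_desc ghk. Qed.

Lemma tri_lift' (A B X Y : D) (f : hom A B) (g : hom B X) (h : hom X Y) :
  tri T f g h -> forall (Z : D) (k : hom Z X), h ∘ k = 0 ->
  exists k' : hom Z B, k = g ∘ k'.
Proof. by move=> fgh; have [Z [k ghk]] := tri_rot fgh; apply: tri_lift ghk. Qed.

(** The fiber [m] of [G] lifts componentwise through the [f k], hence factors through [F]. So a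
    morphism that kills [F] kills [m] and descends along [G]. *)
Lemma product_desc (I : small) (A B X Y : I -> D)
    (f : forall k, hom (A k) (B k)) (g : forall k, hom (B k) (X k))
    (h : forall k, hom (X k) (Y k))
    (PA PB PX : D) (a : forall k, hom PA (A k)) (b : forall k, hom PB (B k))
    (x : forall k, hom PX (X k)) (F : hom PA PB) (G : hom PB PX) :
  (forall k, tri T (f k) (g k) (h k)) ->
  is_product a -> is_product b -> is_product x ->
  (forall k, b k ∘ F = f k ∘ a k) -> (forall k, x k ∘ G = g k ∘ b k) ->
  forall (Z : D) (u : hom PB Z), u ∘ F = 0 -> exists u' : hom PX Z, u = u' ∘ G.
Proof.
move=> fgh aP bP xP FE GE Z u uF.
have [Q [Y' [m [n mGn]]]] := tri_fiber G.
have mlift k : exists t : hom Q (A k), b k ∘ m = f k ∘ t.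
  apply: (tri_lift (fgh k)).
  by rewrite homA -GE -homA (tri_comp0 mGn) comp0r.
have [t tP] := product_lift aP (fun k => sval (cid (mlift k))).
have mE : m = F ∘ t.
  apply: (product_ext bP) => k; rewrite homA FE -homA tP.
  by case: cid.
by apply: (tri_desc mGn); rewrite mE homA uF comp0l.
Qed.

Local Notation S := (full_subcat (le0 W)).

(** A presentation of [hom (-) X] restricted to S by two representable functors. *)
Record approximation (X : D) := Approximation {
  ap_ob : S;
  ap_rel : S;
  ap_map : hom (sval ap_ob) X;
  ap_d : hom (sval ap_rel) (sval ap_ob);
  ap_mapd : ap_map ∘ ap_d = 0;
  ap_lift : forall (Y : S) (u : hom (sval Y) X),
    exists u' : hom (sval Y) (sval ap_ob), ap_map ∘ u' = u;
  ap_factor : forall (Y : S) (u : hom (sval Y) (sval ap_ob)), ap_map ∘ u = 0 ->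
    exists u' : hom (sval Y) (sval ap_rel), ap_d ∘ u' = u }.

(** Two truncations: [L] truncates [X], and [V] truncates the fiber of [L -> X]. Morphisms from S
    lift because the cofibers have weight at least 1. *)
Lemma approximation_ex X : exists _ : approximation X, True.
Proof.
have [L [R [Y [p [g [h [L0 R1 pgh]]]]]]] := weights_decomp0 W X.
have [Z [k kpg]] := tri_unrot pgh.
have [V [R' [Y' [v [g' [h' [V0 R1' vg'h']]]]]]] := weights_decomp0 W Z.
have pkv : p ∘ (k ∘ v) = 0 by rewrite homA (tri_comp0 kpg) comp0l.
unshelve eexists (@Approximation X (exist _ L L0) (exist _ V V0) p (k ∘ v) pkv _ _) => //.
  move=> Q u; have [u' ->] := tri_lift pgh (proj1 (ge1P W R) R1 _ (svalP Q) (g ∘ u)).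
  by exists u'.
move=> Q u pu; have [u' ->] := tri_lift kpg pu.
have [u'' ->] := tri_lift vg'h' (proj1 (ge1P W R') R1' _ (svalP Q) (g' ∘ u')).
by exists u''; rewrite homA.
Qed.

Definition approx X : approximation X := sval (cid (approximation_ex X)).
Local Notation L X := (ap_ob (approx X)).
Local Notation V X := (ap_rel (approx X)).
Local Notation p X := (ap_map (approx X)).
Local Notation d X := (ap_d (approx X)).

Lemma approx_lift X (Y : S) (u : hom (sval Y) X) :
  exists u' : hom (sval Y) (sval (L X)), p X ∘ u' = u.
Proof. exact: ap_lift. Qed.

(** * The left extension of a functor on objects of weight at most 0 *)

Section LeftExtension.
Variable K : ab_functor S.

Definition relations X (a : K (L X)) : Prop := exists v, sub_fmap K (d X) v = a.

Lemma relations0 X : relations (0 : K (L X)).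
Proof. by exists 0; rewrite raddf0. Qed.

Lemma relationsB X (a b : K (L X)) : relations a -> relations b -> relations (a - b).
Proof. by move=> [u <-] [v <-]; exists (u - v); rewrite raddfB. Qed.

Lemma relationsD X (a b : K (L X)) : relations a -> relations b -> relations (a + b).
Proof. by move=> [u <-] [v <-]; exists (u + v); rewrite raddfD. Qed.

Lemma relations_zero (Y : S) X (u : hom (sval Y) (sval (L X))) (a : K Y) :
  p X ∘ u = 0 -> relations (sub_fmap K u a).
Proof.
move=> /ap_factor[u' <-]; exists (sub_fmap K u' a).
by rewrite -sub_fmap_comp.
Qed.

Lemma relations_eq (Y : S) X (u v : hom (sval Y) (sval (L X))) (a : K Y) :
  p X ∘ u = p X ∘ v -> relations (sub_fmap K u a - sub_fmap K v a).
Proof.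
by move=> uv; rewrite -sub_fmapB; apply: relations_zero; rewrite compBr uv subrr.
Qed.

Lemma relations_map X Y (f : hom X Y) (f' : hom (sval (L X)) (sval (L Y)))
    (a : K (L X)) :
  p Y ∘ f' = f ∘ p X -> relations a -> relations (sub_fmap K f' a).
Proof.
move=> ff' [v <-]; rewrite -sub_fmap_comp; apply: relations_zero.
by rewrite homA ff' -homA ap_mapd comp0r.
Qed.

Definition is_left_extension (H : ab_functor D)
    (q : forall X, {additive K (L X) -> H X}) : Prop :=
  [/\ forall X y, exists a, q X a = y,
      forall X a, q X a = 0 <-> relations a &
      forall X Y (f : hom X Y) (f' : hom (sval (L X)) (sval (L Y))),
        p Y ∘ f' = f ∘ p X ->
        forall a, fmap H f (q X a) = q Y (sub_fmap K f' a)].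

(** A morphism acts through any lift to the precovers ([act]); by [relations_eq] the class of the
    result does not depend on the lift, which gives both functoriality and additivity. *)
Lemma left_extension_ex :
  exists (H : ab_functor D) (q : forall X, {additive K (L X) -> H X}),
    is_left_extension q.
Proof.
have qex X := quotient_ex (@relations0 X) (@relationsB X).
pose Q X := sval (cid (qex X)).
pose q X : {additive K (L X) -> Q X} := sval (cid (svalP (cid (qex X)))).
have qP X : (forall y, exists a, q X a = y) /\ forall a, q X a = 0 <-> relations a.
  exact: (svalP (cid (svalP (cid (qex X))))).
have qeq X a b : q X a = q X b <-> relations (a - b).
  rewrite -(qP X).2 raddfB; split=> [->|/eqP]; first by rewrite subrr.
  by rewrite subr_eq0 => /eqP.
pose act X Y (f : hom X Y) x y := exists a (f' : hom (sval (L X)) (sval (L Y))),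
  [/\ p Y ∘ f' = f ∘ p X, q X a = x & q Y (sub_fmap K f' a) = y].
have actE X Y (f : hom X Y) (f' : hom (sval (L X)) (sval (L Y))) a y :
    p Y ∘ f' = f ∘ p X -> act X Y f (q X a) y -> y = q Y (sub_fmap K f' a).
  move=> f'E [b [f'' [f''E ba <-]]]; apply/qeq.
  have -> : sub_fmap K f'' b - sub_fmap K f' a =
    sub_fmap K f'' (b - a) + (sub_fmap K f'' a - sub_fmap K f' a).
    by rewrite raddfB addrA subrK.
  apply: relationsD; first by apply: (relations_map f''E); apply/qeq.
  by apply: relations_eq; rewrite f'E f''E.
have actI X Y (f : hom X Y) (f' : hom (sval (L X)) (sval (L Y))) a :
    p Y ∘ f' = f ∘ p X -> act X Y f (q X a) (q Y (sub_fmap K f' a)).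
  by move=> f'E; exists a, f'.
have lift X Y (f : hom X Y) : exists f' : hom (sval (L X)) (sval (L Y)),
    p Y ∘ f' = f ∘ p X by exact: approx_lift.
have [||||||H [i [j [ij ji iP]]]] := @functor_of_relation D Q act.
- move=> X Y f x; have [f' f'E] := lift X Y f.
  by have [a <-] := (qP X).1 x; exists (q Y (sub_fmap K f' a)); apply: actI.
- move=> X Y f x y y' [a [f' [f'E <- <-]]] h; exact/esym/(actE _ _ _ _ _ _ f'E h).
- move=> X Y f x y x' y' [a [f' [f'E <- <-]]] h.
  have [b xb] := (qP X).1 x'; move: h; rewrite -xb => /(actE _ _ _ _ _ _ f'E) ->.
  by rewrite -!raddfB; apply: actI.
- move=> X x; have [a <-] := (qP X).1 x; exists a, (idm (sval (L X))).
  by rewrite hom1l hom1r sub_fmap_id.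
- move=> X Y Z g f x y z [a [f' [f'E <- <-]]].
  have [g' g'E] := lift Y Z g; move=> /(actE _ _ _ _ _ _ g'E) ->.
  by rewrite -sub_fmap_comp; apply: actI; rewrite homA g'E -!homA f'E.
- move=> X Y f g x y z [a [f' [f'E <- <-]]].
  have [g' g'E] := lift X Y g; move=> /(actE _ _ _ _ _ _ g'E) ->.
  rewrite -raddfD -sub_fmapD; apply: actI.
  by rewrite homDl homDr f'E g'E.
exists H, (fun X => i X \o q X); split=> [X y|X a|X Y f f' f'E a] /=.
- have [a aE] := (qP X).1 (j X y).
  by exists a; rewrite aE ji.
- rewrite -(qP X).2; split=> h; last by rewrite h raddf0.
  by apply: (can_inj (ij X)); rewrite raddf0.
- by apply: iP; apply: actI.
Qed.

Section LeftExtensionProperties.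
Variables (H : ab_functor D) (q : forall X, {additive K (L X) -> H X}).
Hypothesis Hq : is_left_extension q.

Lemma left_extension_eq X (a b : K (L X)) : relations (a - b) -> q X a = q X b.
Proof.
have [_ q0 _] := Hq; move=> /q0; rewrite raddfB => /eqP.
by rewrite subr_eq0 => /eqP.
Qed.

Lemma left_extension_ge1 X : ge1 W X -> forall x : H X, x = 0.
Proof.
have [qs q0 _] := Hq; move=> X1 x; have [a <-] := qs X x; apply/q0.
rewrite -(sub_fmap_id a); apply: relations_zero.
by rewrite hom1r; apply: (proj1 (ge1P W X) X1); exact: svalP.
Qed.

(** That [y] dies in [H X] is witnessed by an element [v] of [K (V X)]. The pair ([b], [v]) is then
    an element of [K] on [L B] + [V X] killed by [u], to which the exactness of [K] applies. *)
Lemma left_extension_exact :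
  (forall (A B X : S) (Y : D) (f : hom (sval A) (sval B))
     (g : hom (sval B) (sval X)) (h : hom (sval X) Y), tri T f g h ->
     forall b : K B, sub_fmap K g b = 0 -> exists a, sub_fmap K f a = b) ->
  forall (A B X Y : D) (f : hom A B) (g : hom B X) (h : hom X Y), tri T f g h ->
  forall y : H B, fmap H g y = 0 -> exists x, fmap H f x = y.
Proof.
move=> Kex A B X Y f g h fgh y; have [qs q0 qn] := Hq.
have [b <-] := qs B y; have [g' g'E] := approx_lift (g ∘ p B).
rewrite (qn _ _ g g' g'E) => /q0 [v vE].
have [P PB] := tri_biproduct T (sval (L B)) (sval (V X)).
have P0 : le0 W P by apply: le0_biproduct PB _ _; exact: svalP.
pose P' : S := exist _ P P0.
have [i [j [r [s [ri sj rj si _]]]]] := PB.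
pose u := g' ∘ r - d X ∘ s.
(* [Q] is a homotopy pullback of [g'] and [d X]. The composite from [Q] to [B] becomes zero in [X],
   so it comes from a morphism [w] to [A], and the element [c] of [K Q] gives the preimage. *)
have [Q [Z [m [n mun]]]] := tri_fiber u.
have Q0 : le0 W Q by by apply: (le0_fiber mun P0); exact: svalP.
pose Q' : S := exist _ Q Q0.
pose b' := sub_fmap K (X := L B) (Y := P') i b + sub_fmap K (X := V X) (Y := P') j v.
have ub' : sub_fmap K (X := P') (Y := L X) u b' = 0.
  rewrite /b' raddfD -!sub_fmap_comp /u !compBl -!homA ri si sj rj.
  rewrite !comp0r !hom1r subr0 sub0r -[- d X]sub0r sub_fmapB sub_fmap0 sub0r.
  by rewrite vE subrr.
have [c cE] := Kex Q' P' (L X) Z m u n mun b' ub'.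
have rb' : sub_fmap K (X := P') (Y := L B) r b' = b.
  by rewrite /b' raddfD -!sub_fmap_comp ri rj sub_fmap_id sub_fmap0 addr0.
have [w wE] : exists w : hom Q A, p B ∘ r ∘ m = f ∘ w.
  apply: (tri_lift fgh); have um := tri_comp0 mun.
  have {um} um : g' ∘ r ∘ m = d X ∘ s ∘ m.
    by apply/eqP; rewrite -subr_eq0 -compBl um.
  by rewrite !homA -g'E -!(homA (p X)) um !homA ap_mapd !comp0l.
have [w' w'E] := approx_lift (w : hom (sval Q') A).
have [f' f'E] := approx_lift (f ∘ p A).
exists (q A (sub_fmap K w' c)); rewrite (qn _ _ f f' f'E); apply: left_extension_eq.
rewrite -rb' -cE -!sub_fmap_comp; apply: relations_eq.
by rewrite !homA f'E -homA w'E -wE.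
Qed.

(** For [Y] in S the identity lifts to a section [s Y] of the precover; it identifies [K Y] with
    [H Y], and [e] is the inverse. *)
Lemma left_extension_restrict :
  exists e : forall Y : S, {additive H (sval Y) -> K Y},
  [/\ forall Y, bijective (e Y),
      forall (X Y : S) (f : hom (sval X) (sval Y)) x,
        e Y (fmap H f x) = sub_fmap K f (e X x) &
      forall (Y : S) a, e Y (q (sval Y) a) = sub_fmap K (p (sval Y)) a].
Proof.
have [qs q0 qn] := Hq.
have sex (Y : S) : exists s : hom (sval Y) (sval (L (sval Y))),
    p (sval Y) ∘ s = idm (sval Y).
  exact: approx_lift.
pose s (Y : S) := sval (cid (sex Y)).
have ps Y : p (sval Y) ∘ s Y = idm (sval Y) := svalP (cid (sex Y)).
pose e' (Y : S) (a : K Y) : H (sval Y) := q (sval Y) (sub_fmap K (s Y) a).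
have e'E (Y : S) a : e' Y (sub_fmap K (p (sval Y)) a) = q (sval Y) a.
  apply: left_extension_eq; rewrite -sub_fmap_comp -[X in _ - X]sub_fmap_id.
  by apply: relations_eq; rewrite homA ps hom1l hom1r.
have e'surj (Y : S) x : exists a, e' Y a = x.
  by have [a <-] := qs _ x; exists (sub_fmap K (p (sval Y)) a).
have e'inj (Y : S) : injective (e' Y).
  move=> a b ab; apply/eqP; rewrite -subr_eq0; apply/eqP.
  have /q0 [v vE] : q (sval Y) (sub_fmap K (s Y) (a - b)) = 0.
    by rewrite !raddfB; apply/eqP; rewrite subr_eq0; apply/eqP; exact: ab.
  rewrite -(sub_fmap_id (a - b)) -ps sub_fmap_comp -vE -sub_fmap_comp ap_mapd.
  by rewrite sub_fmap0.
pose e0 (Y : S) x := sval (cid (e'surj Y x)).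
have e0K Y : cancel (e0 Y) (e' Y) by move=> x; exact: (svalP (cid (e'surj Y x))).
have e'K Y : cancel (e' Y) (e0 Y) by move=> x; apply: e'inj; rewrite e0K.
have e0B Y : zmod_morphism (e0 Y).
  by move=> x y; apply: e'inj; rewrite e0K /e' !raddfB -!/(e' Y _) !e0K.
exists (fun Y => HB.pack_for {additive H (sval Y) -> K Y} (e0 Y)
    (GRing.isZmodMorphism.Build _ _ (e0 Y) (e0B Y))); split=> /=.
- by move=> Y; exists (e' Y).
- move=> X Y f x; rewrite -{1}(e0K X x) /e'.
  have [f' f'E] := approx_lift (f ∘ p (sval X)).
  rewrite (qn _ _ f f' f'E) -e'E e'K -!sub_fmap_comp; congr (sub_fmap K _ _).
  by rewrite f'E -homA ps hom1r.
- by move=> Y a; rewrite -e'E e'K.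
Qed.

(** The products [PL] and [PV] of the chosen presentations play the role of a presentation of [P];
    [r] and [s] compare [PL] with the chosen precover of [P], over [P]. *)
Lemma left_extension_products :
  has_products D -> closed_under_products (le0 W) -> preserves_products K ->
  respects_products H.
Proof.
move=> hP clP Kprod I M P pr prP y; have [qs q0 qn] := Hq.
have [PL [a aP]] := hP I (fun k => sval (L (M k))).
have PL0 : le0 W PL by apply: clP aP _ => k; exact: svalP.
pose PL' : S := exist _ PL PL0.
have [PV [v vP]] := hP I (fun k => sval (V (M k))).
have PV0 : le0 W PV by apply: clP vP _ => k; exact: svalP.
pose PV' : S := exist _ PV PV0.
have [F FE] := product_lift aP (fun k => d (M k) ∘ v k).
have [G GE] := product_lift prP (fun k => p (M k) ∘ a k).
have [r rE] := approx_lift (G : hom (sval PL') P).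
have prlift k := approx_lift (pr k ∘ p P).
pose pr' k := sval (cid (prlift k)).
have pr'E k : p (M k) ∘ pr' k = pr k ∘ p P := svalP (cid (prlift k)).
have [s sE] := product_lift aP pr'.
have rsp : p P ∘ (r ∘ s) = p P.
  apply: (product_ext prP) => k; rewrite !homA -(homA (pr k)) rE GE -homA sE.
  exact: pr'E.
have [b bE] : exists b : forall k, K (L (M k)), forall k, q (M k) (b k) = y k.
  by exists (fun k => sval (cid (qs _ (y k)))) => k; case: cid.
have prrE k (c : K PL') : fmap H (pr k) (q P (sub_fmap K r c)) =
    q (M k) (sub_fmap K (X := PL') (a k) c).
  rewrite (qn _ _ _ _ (pr'E k)) -sub_fmap_comp; apply: left_extension_eq.
  by apply: relations_eq; rewrite homA pr'E -homA rE GE.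
have [c [cE _]] := Kprod I (fun k => L (M k)) PL' a aP b.
exists (q P (sub_fmap K r c)); split=> [k|x xE]; first by rewrite prrE cE.
have [x' x'E] : exists x', q P x' = x - q P (sub_fmap K r c) by exact: qs.
apply/esym/eqP; rewrite -subr_eq0 -x'E; apply/eqP/q0.
have x'N k : relations (sub_fmap K (pr' k) x').
  apply/q0; rewrite -(qn _ _ _ _ (pr'E k)) x'E raddfB xE prrE cE bE.
  by rewrite subrr.
pose z k := sval (cid (x'N k)).
have zE k : sub_fmap K (d (M k)) (z k) = sub_fmap K (pr' k) x' := svalP (cid (x'N k)).
have [z' [z'E _]] := Kprod I (fun k => V (M k)) PV' v vP z.
have sx' : sub_fmap K (X := L P) (Y := PL') s x' =
    sub_fmap K (X := PV') (Y := PL') F z'.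
  have [t [tE tU]] := Kprod I (fun k => L (M k)) PL' a aP
    (fun k => sub_fmap K (pr' k) x').
  rewrite -(tU (sub_fmap K (X := L P) (Y := PL') s x')) => [|k]; last first.
    by rewrite -sub_fmap_comp sE.
  by apply: tU => k; rewrite -sub_fmap_comp FE sub_fmap_comp z'E zE.
(* Both summands are relations: [r ∘ s] agrees with the identity after [p P], and [r ∘ F] is killed
   by [p P]. *)
have -> : x' = (sub_fmap K (idm (sval (L P))) x' -
    sub_fmap K (X := L P) (Y := L P) (r ∘ s) x') +
    sub_fmap K (X := PV') (Y := L P) (r ∘ F) z'.
  by rewrite sub_fmap_id !sub_fmap_comp -sx' subrK.
apply: relationsD; first by apply: relations_eq; rewrite rsp hom1r.
apply: relations_zero; rewrite homA rE.
apply: (product_ext prP) => k; rewrite homA GE -homA FE homA ap_mapd.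
by rewrite comp0l comp0r.
Qed.

End LeftExtensionProperties.
End LeftExtension.
End Weights.

(** * Consequences of representability *)

Section DependentProduct.
Variables (I : small) (V : I -> zmodType).

Definition dprod : Type := forall k, V k.

HB.instance Definition _ := gen_eqMixin dprod.
HB.instance Definition _ := gen_choiceMixin dprod.

Definition dprod_zero : dprod := fun k => 0.
Definition dprod_opp (x : dprod) : dprod := fun k => - x k.
Definition dprod_add (x y : dprod) : dprod := fun k => x k + y k.

Lemma dprod_addA : associative dprod_add.
Proof. by move=> x y z; apply: functional_extensionality_dep => k; exact: addrA. Qed.
Lemma dprod_addC : commutative dprod_add.
Proof. by move=> x y; apply: functional_extensionality_dep => k; exact: addrC. Qed.
Lemma dprod_add0 : left_id dprod_zero dprod_add.
Proof. by move=> x; apply: functional_extensionality_dep => k; exact: add0r. Qed.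
Lemma dprod_addN : left_inverse dprod_zero dprod_opp dprod_add.
Proof. by move=> x; apply: functional_extensionality_dep => k; exact: addNr. Qed.

HB.instance Definition _ :=
  GRing.isZmodule.Build dprod dprod_addA dprod_addC dprod_add0 dprod_addN.
End DependentProduct.

Lemma dprod_morphism (I : small) (U V : I -> zmodType)
    (f : forall k, {additive U k -> V k}) :
  zmod_morphism ((fun x k => f k (x k)) : dprod U -> dprod V).
Proof. by move=> x y; apply: functional_extensionality_dep => k; exact: raddfB. Qed.

Section ProductFunctor.
Variables (D : preadditive) (I : small) (F : I -> ab_functor D).

Lemma product_functor_ex : exists (G : ab_functor D)
    (e : forall X, {additive G X -> dprod (fun k => F k X)}),
  (forall X, bijective (e X)) /\
  forall X Y (f : hom X Y) x k, e Y (fmap G f x) k = fmap (F k) f (e X x k).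
Proof.
pose V X : zmodType := dprod (fun k => F k X).
pose m X Y (f : hom X Y) : V X -> V Y := fun x k => fmap (F k) f (x k).
have mB X Y f : zmod_morphism (m X Y f) by exact: dprod_morphism.
pose m' X Y f := HB.pack_for {additive V X -> V Y} (m X Y f)
    (GRing.isZmodMorphism.Build _ _ (m X Y f) (mB X Y f)).
unshelve eexists (@AbFunctor D V m' _ _ _).
- by move=> X x; apply: functional_extensionality_dep => k; exact: fmap_id.
- by move=> X Y Z g f x; apply: functional_extensionality_dep => k; exact: fmap_comp.
- by move=> X Y f g x; apply: functional_extensionality_dep => k; exact: fmapD.
by exists (fun X => idfun : {additive V X -> V X}); split=> // X; exists idfun.
Qed.
End ProductFunctor.

Lemma hom_functor_exact (D : preadditive) (T : triangulation D) (N : D)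
    (A B X Y : D) (f : hom A B) (g : hom B X) (h : hom X Y) :
  tri T f g h -> forall y : hom_functor N B, fmap (hom_functor N) g y = 0 ->
  exists x, fmap (hom_functor N) f x = y.
Proof. by move=> fgh y /(tri_lift fgh)[x ->]; exists x. Qed.

(** The other half of exactness is [tri_comp0]; thus this covers homological functors on a
    triangulated category and cohomological ones, viewed on the opposite category. *)
Definition abstract_brown (D : preadditive) (T : triangulation D) : Prop :=
  has_products D /\ forall F : ab_functor D,
    (forall (A B X Y : D) (f : hom A B) (g : hom B X) (h : hom X Y),
      tri T f g h -> forall y : F B, fmap F g y = 0 ->
      exists x, fmap F f x = y) ->
    respects_products F -> corepresentable F.

Section Brown.
Variables (D : preadditive) (T : triangulation D).
Hypothesis brownT : abstract_brown T.

(** The product of the functors [hom (M k) (-)] is exact and respects products; an object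
    corepresenting it is a coproduct of the [M k]. *)
Lemma brown_coproducts : has_coproducts D.
Proof.
move=> I M.
have [G [e [ebij eE]]] := product_functor_ex (fun k => @hom_functor D (M k)).
have einj X x y : (forall k, e X x k = e X y k) -> x = y.
  by move=> xy; apply: (bij_inj (ebij X)); exact: functional_extensionality_dep.
have e0 X k : e X 0 k = 0 by rewrite raddf0.
have esurj X y : exists x, e X x = y by have [e' _ e'K] := ebij X; exists (e' y).
have [||P [phi phiP]] := brownT.2 G.
- move=> A B X Y f g h fgh y gy.
  have yex k : exists x, fmap (@hom_functor D (M k)) f x = e B y k.
    by apply: (hom_functor_exact fgh); rewrite -eE gy e0.
  have [x xE] := esurj A (fun k => sval (cid (yex k))).
  by exists x; apply: einj => k; rewrite eE xE; case: cid.
- move=> J N P p pP y.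
  have zex k : exists z : @hom D (M k) P, forall j, p j ∘ z = e (N j) (y j) k.
    by have [z [zP _]] := pP _ (fun j => e (N j) (y j) k); exists z.
  have [x xE] := esurj P (fun k => sval (cid (zex k))).
  have xP j : fmap G (p j) x = y j.
    by apply: einj => k; rewrite eE xE; case: cid => z /= ->.
  exists x; split=> // x' x'P; apply: einj => k.
  by apply: (product_ext pP) => j; rewrite -!eE xP x'P.
have phiE X (f : hom P X) k : e X (phi X f) k = f ∘ e P (phi P (idm P)) k.
  by have := ntP phi f (idm P); rewrite /= hom1r => ->; rewrite eE.
exists P, (fun k => e P (phi P (idm P)) k) => N f.
have [g gE] := esurj N f; have [psi phiK psiK] := phiP N.
exists (psi g); split=> [k|h hE] /=; first by rewrite -phiE psiK gE.
rewrite -(phiK h); congr (psi _); apply: einj => k.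
by rewrite phiE gE; exact/esym/hE.
Qed.

Variable W : weights T.
Hypothesis le0_products : closed_under_products (le0 W).

Local Notation S := (full_subcat (le0 W)).

Lemma left_extension_corepresentable (K : ab_functor S) :
  (forall (A B X : S) (Y : D) (f : hom (sval A) (sval B))
     (g : hom (sval B) (sval X)) (h : hom (sval X) Y), tri T f g h ->
     forall b : K B, sub_fmap K g b = 0 -> exists a, sub_fmap K f a = b) ->
  preserves_products K ->
  exists2 N : D, le0 W N &
    exists phi : forall Y : S, {additive hom N (sval Y) -> K Y},
    (forall Y, bijective (phi Y)) /\
    forall (X Y : S) (f : hom (sval X) (sval Y)) (x : hom N (sval X)),
      phi Y (f ∘ x) = sub_fmap K f (phi X x).
Proof.
move=> Kex Kprod; have [H [q Hq]] := left_extension_ex K.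
have [||N [phi phiP]] := brownT.2 H.
- exact: left_extension_exact Hq Kex.
- exact: left_extension_products Hq brownT.1 le0_products Kprod.
have [e [ebij enat _]] := left_extension_restrict Hq.
exists N.
  (* [hom N Y] is isomorphic to [H Y], which vanishes for [Y] of weight at least 1. *)
  apply/(le0P W) => Y Y1 f; apply: (bij_inj (phiP Y)).
  by rewrite !(left_extension_ge1 Hq Y1 (phi _ _)).
exists (fun Y => e Y \o phi (sval Y)); split=> [Y|X Y f x] /=.
  exact: (bij_comp (ebij Y) (phiP (sval Y))).
by rewrite -enat; congr (e Y _); exact: (ntP phi f x).
Qed.

(** The object [A] corepresents [hom M (-)] on S, so [a] is universal among morphisms from [M] to S.
    That its fiber [B] is left orthogonal to S is an argument in the style of Wakamatsu's lemma. *)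
Lemma le0_truncation (M : D) :
  exists (B A Y : D) (b : hom B M) (a : hom M A) (h : hom A Y),
  [/\ tri T b a h, le0 W A & forall X, le0 W X -> forall f : hom B X, f = 0].
Proof.
pose K := ab_restrict (le0 W) (hom_functor M).
have [||A A0 [phi [phibij phiE]]] := @left_extension_corepresentable K.
- by move=> A B X Y f g h fgh; exact: (hom_functor_exact fgh).
- by move=> I N P p pP y; exact: pP.
pose A' : S := exist _ A A0; pose a : hom M A := phi A' (idm A).
have aE (Y : S) (f : hom A (sval Y)) : phi Y f = f ∘ a.
  by rewrite -{1}(hom1r f) (phiE A' Y).
have asurj Y (Y0 : le0 W Y) (f : hom M Y) : exists f', f' ∘ a = f.
  have [psi _ psiK] := phibij (exist _ Y Y0); exists (psi f).
  by rewrite -(aE (exist _ Y Y0)) psiK.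
have ainj Y (Y0 : le0 W Y) (f g : hom A Y) : f ∘ a = g ∘ a -> f = g.
  by rewrite -!(aE (exist _ Y Y0)); exact: (bij_inj (phibij (exist _ Y Y0))).
have [B [Y [b [h bah]]]] := tri_fiber T a.
exists B, A, Y, b, a, h; split=> // X X0 x.
have [Z [z zba]] := tri_unrot bah.
(* [U] is the extension of [A] by [X] classified by the shift of [x ∘ z]. It lies in S, and [a]
   lifts to it since [y ∘ a = 0]; by universality the lift gives a section of [i], so [y = 0]. Then
   [x] factors through [M], hence through [a ∘ b = 0]. *)
have [U [Y' [j [i [y [jiy ya xz]]]]]] := tri_shift zba x.
have U0 : le0 W U := le0_extension jiy X0 A0.
have [u uE] := tri_lift' jiy ya.
have [r rE] := asurj U U0 u.
have ir : i ∘ r = idm A.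
  by apply: (ainj A A0); rewrite -homA rE hom1l.
have y0 : y = 0 by rewrite -(hom1r y) -ir homA (tri_comp0' jiy) comp0l.
have [x' ->] := tri_desc zba (xz y0).
have [x'' <-] := asurj X X0 x'.
by rewrite -homA (tri_comp0 bah) comp0r.
Qed.
End Brown.

(** * Right extensions of functors on the heart *)

Section Heart.
Variables (D : preadditive) (T : triangulation D) (W : weights T).

Definition heart (X : D) : Prop := le0 W X /\ ge0 W X.
(** Objects of the heart of the t-structure whose nonpositive part is [le0 W]: left orthogonality to
    weight at most -1 says that the object is nonnegative. *)
Definition t_heart_ob (X : D) : Prop :=
  le0 W X /\ forall Y, lem1 W Y -> forall f : hom X Y, f = 0.

Local Notation S := (full_subcat (le0 W)).
Local Notation Hw := (full_subcat heart).

(** The object is truncated into the heart, then the cofiber [en_M] is truncated again; [en_e] is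
    the resulting differential. The triangles themselves are recorded, as lifting from the left and
    taking products both use them. *)
Record envelope (Y : D) := Envelope {
  en_ob : Hw;
  en_rel : Hw;
  en_map : hom Y (sval en_ob);
  en_e : hom (sval en_ob) (sval en_rel);
  en_L : D;
  en_l : hom en_L Y;
  en_M : D;
  en_h : hom (sval en_ob) en_M;
  en_N : D;
  en_n : hom en_N en_M;
  en_j : hom en_M (sval en_rel);
  en_Z : D;
  en_z : hom (sval en_rel) en_Z;
  en_tri : tri T en_l en_map en_h;
  en_tri' : tri T en_n en_j en_z;
  en_Lm1 : lem1 W en_L;
  en_Nm1 : lem1 W en_N;
  en_eE : en_e = en_j ∘ en_h }.

(** [M] is a shift of [L], so it has weight at most 0, and [P] is an extension of [M] by [Y]. *)
Lemma ge0_truncation (Y : D) : le0 W Y ->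
  exists (L P M : D) (l : hom L Y) (i : hom Y P) (h : hom P M),
  [/\ tri T l i h, lem1 W L, heart P & le0 W M].
Proof.
move=> Y0; have [L [P [M [l [i [h [L1 P0 lih]]]]]]] := weights_decompm1 W Y.
have M0 : le0 W M by apply/(weights_shift_le W lih).
exists L, P, M, l, i, h; split=> //; split=> //.
by have [Z [k ihk]] := tri_rot lih; exact: le0_extension ihk Y0 M0.
Qed.

Lemma envelope_ex (Y : S) : exists _ : envelope (sval Y), True.
Proof.
have [L [P [M [l [i [h [lih L1 P0 M0]]]]]]] := ge0_truncation (svalP Y).
have [N [R [Z [n [j [z [njz N1 R0 Z0]]]]]]] := ge0_truncation M0.
by exists (@Envelope _ (exist _ P P0) (exist _ R R0) i (j ∘ h) _ l _ h
  _ n j _ z lih njz L1 N1 erefl).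
Qed.

Definition env (Y : S) : envelope (sval Y) := sval (cid (envelope_ex Y)).
Local Notation E Y := (en_ob (env Y)).
Local Notation R Y := (en_rel (env Y)).
Local Notation i Y := (en_map (env Y)).
Local Notation e Y := (en_e (env Y)).

Lemma env_ei (Y : S) : e Y ∘ i Y = 0.
Proof. by rewrite en_eE -homA (tri_comp0' (en_tri _)) comp0r. Qed.

Lemma env_extend (Y : S) (Q : D) (u : hom (sval Y) Q) : ge0 W Q ->
  exists u' : hom (sval (E Y)) Q, u' ∘ i Y = u.
Proof.
move=> Q0; have uL := proj1 (ge0P W Q) Q0 _ (en_Lm1 (env Y)) (u ∘ en_l (env Y)).
by have [u' ->] := tri_desc (en_tri (env Y)) uL; exists u'.
Qed.

Lemma env_factor (Y : S) (Q : D) (u : hom (sval (E Y)) Q) : ge0 W Q ->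
  u ∘ i Y = 0 -> exists u' : hom (sval (R Y)) Q, u' ∘ e Y = u.
Proof.
move=> Q0 ui; have [v ->] := tri_desc' (en_tri (env Y)) ui.
have vN := proj1 (ge0P W Q) Q0 _ (en_Nm1 (env Y)) (v ∘ en_n (env Y)).
have [u' ->] := tri_desc (en_tri' (env Y)) vN.
by exists u'; rewrite en_eE homA.
Qed.

(** Together with [env_mono]: for nonnegative [Q] in the t-structure, [hom Q Y] is the kernel of
    [hom Q (E Y) -> hom Q (R Y)]. Morphisms to [Y] are thus read off from the heart of the weight
    structure. *)
Lemma env_lift (Y : S) (Q : D) (u : hom Q (sval (E Y))) :
  (forall Z, lem1 W Z -> forall f : hom Q Z, f = 0) ->
  e Y ∘ u = 0 -> exists u' : hom Q (sval Y), i Y ∘ u' = u.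
Proof.
rewrite en_eE => Qm1; rewrite -homA => hu0.
have [v vE] := tri_lift (en_tri' (env Y)) hu0.
have hu : en_h (env Y) ∘ u = 0 by rewrite vE (Qm1 _ (en_Nm1 (env Y)) v) comp0r.
by have [u' ->] := tri_lift' (en_tri (env Y)) hu; exists u'.
Qed.

Lemma env_mono (Y : S) (Q : D) (u : hom Q (sval Y)) :
  (forall Z, lem1 W Z -> forall f : hom Q Z, f = 0) -> i Y ∘ u = 0 -> u = 0.
Proof.
move=> Qm1 /(tri_lift (en_tri (env Y)))[v ->].
by rewrite (Qm1 _ (en_Lm1 (env Y)) v) comp0r.
Qed.

(** * The right extension of a functor on the heart to objects of weight at most 0 *)

Section RightExtension.
Variable F : ab_functor Hw.

Definition is_right_extension (K : ab_functor S)
    (r : forall Y : S, {additive K Y -> F (E Y)}) : Prop :=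
  [/\ forall Y, injective (r Y),
      forall Y a, sub_fmap F (e Y) a = 0 <-> exists x, r Y x = a &
      forall (X Y : S) (f : hom (sval X) (sval Y))
        (f' : hom (sval (E X)) (sval (E Y))), f' ∘ i X = i Y ∘ f ->
        forall x, r Y (sub_fmap K f x) = sub_fmap F f' (r X x)].

Lemma env_zero (X : S) (Q : Hw) (u : hom (sval (E X)) (sval Q)) (a : F (E X)) :
  sub_fmap F (e X) a = 0 -> u ∘ i X = 0 -> sub_fmap F u a = 0.
Proof.
move=> ea ui; have [u' <-] := env_factor (svalP Q).2 ui.
by rewrite sub_fmap_comp ea raddf0.
Qed.

Lemma env_eq (X : S) (Q : Hw) (u v : hom (sval (E X)) (sval Q)) (a : F (E X)) :
  sub_fmap F (e X) a = 0 -> u ∘ i X = v ∘ i X -> sub_fmap F u a = sub_fmap F v a.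
Proof.
move=> ea uv; apply/eqP; rewrite -subr_eq0 -sub_fmapB; apply/eqP.
by apply: env_zero; rewrite // compBl uv subrr.
Qed.

(** A morphism acts through any extension to the envelopes; two extensions differ by a morphism
    factoring through [e X], which vanishes on the kernel defining [K X]. *)
Lemma right_extension_ex :
  exists (K : ab_functor S) (r : forall Y : S, {additive K Y -> F (E Y)}),
    is_right_extension r.
Proof.
pose N (Y : S) (a : F (E Y)) := sub_fmap F (e Y) a = 0.
have N0 Y : N Y 0 by rewrite /N raddf0.
have NB Y a b : N Y a -> N Y b -> N Y (a - b).
  by rewrite /N raddfB => -> ->; rewrite subrr.
have rex Y := subgroup_ex (N0 Y) (NB Y).
pose K Y := sval (cid (rex Y)).
pose r Y : {additive K Y -> F (E Y)} := sval (cid (svalP (cid (rex Y)))).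
have rP Y : injective (r Y) /\ forall a, N Y a <-> exists x, r Y x = a.
  exact: (svalP (cid (svalP (cid (rex Y))))).
have rN Y x : N Y (r Y x) by apply/(rP Y).2; exists x.
pose act (X Y : S) (f : @hom S X Y) (x : K X) (y : K Y) :=
  exists f' : hom (sval (E X)) (sval (E Y)), f' ∘ i X = i Y ∘ f /\
    r Y y = sub_fmap F f' (r X x).
have actE (X Y : S) (f : @hom S X Y) (f' : hom (sval (E X)) (sval (E Y))) x y :
    f' ∘ i X = i Y ∘ f -> act X Y f x y -> r Y y = sub_fmap F f' (r X x).
  by move=> f'E [f'' [f''E ->]]; apply: env_eq; rewrite ?f'E // rN.
have lift (X Y : S) (f : @hom S X Y) :
    exists f' : hom (sval (E X)) (sval (E Y)), f' ∘ i X = i Y ∘ f.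
  by apply: env_extend; exact: (svalP (E Y)).2.
have [||||||G [g [g' [gg' g'g gP]]]] := @functor_of_relation S K act.
- move=> X Y f x; have [f' f'E] := lift X Y f.
  have /(rP Y).2[y yE] : N Y (sub_fmap F f' (r X x)).
    rewrite /N -sub_fmap_comp; apply: env_zero; first exact: rN.
    by rewrite -homA f'E homA env_ei comp0l.
  by exists y, f'.
- move=> X Y f x y y' [f' [f'E yE]] /(actE _ _ _ _ _ _ f'E) y'E.
  by apply: (rP Y).1; rewrite yE y'E.
- move=> X Y f x y x' y' [f' [f'E yE]] /(actE _ _ _ _ _ _ f'E) y'E.
  by exists f'; split=> //; rewrite !raddfB yE y'E.
- move=> X x; exists (idm (sval (E X))); split; last by rewrite sub_fmap_id.
  by rewrite hom1l; exact/esym/hom1r.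
- move=> X Y Z g f x y z [f' [f'E yE]] [g' [g'E zE]].
  exists (g' ∘ f'); split; last by rewrite sub_fmap_comp zE yE.
  by rewrite -homA f'E homA g'E -homA.
- move=> X Y f g x y z [f' [f'E yE]] [g' [g'E zE]].
  exists (f' + g'); split; last by rewrite sub_fmapD raddfD yE zE.
  rewrite homDl f'E g'E; exact/esym/homDr.
exists G, (fun Y => r Y \o g' Y); split=> [Y|Y a|X Y f f' f'E x] /=.
- by apply: inj_comp; [exact: (rP Y).1|exact: can_inj (g'g Y)].
- split=> [/(rP Y).2[x <-]|[x <-]]; first by exists (g Y x); rewrite gg'.
  exact: rN.
- have [y [f'' [f''E yE]]] : exists y, act X Y f (g' X x) y.
    have /(rP Y).2[y yE] : N Y (sub_fmap F f' (r X (g' X x))).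
      rewrite /N -sub_fmap_comp; apply: env_zero; first exact: rN.
      by rewrite -homA f'E homA env_ei comp0l.
    by exists y, f'.
  have fxy : sub_fmap G f x = g Y y.
    by rewrite -(g'g X x); apply: gP; exists f''.
  by rewrite fxy gg' yE; apply: env_eq; rewrite ?f'E // rN.
Qed.

Section RightExtensionProperties.
Variables (K : ab_functor S) (r : forall Y : S, {additive K Y -> F (E Y)}).
Hypothesis Kr : is_right_extension r.

Lemma right_extension_ker Y x : sub_fmap F (e Y) (r Y x) = 0.
Proof. by have [_ re _] := Kr; apply/re; exists x. Qed.

(** [i Y] goes from weight at most -1 to weight at least 0, so it is zero, and by [env_zero] even
    the identity of [E Y] acts by zero on the kernel. This later makes the corepresenting object
    nonnegative for the t-structure. *)
Lemma right_extension_lem1 (Y : S) : lem1 W (sval Y) -> forall x : K Y, x = 0.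
Proof.
have [rinj _ _] := Kr; move=> Y1 x; apply: rinj; rewrite raddf0.
rewrite -(sub_fmap_id (r Y x)).
apply: env_zero; first exact: right_extension_ker.
by rewrite hom1l; apply: (proj1 (ge0P W _) (svalP (E Y)).2).
Qed.

(** The desuspension [Z] of [X] has weight at most -1, so [i A] extends along [f] and yields [l']
    from [E B] to [E A]. The preimage of [b] is its image under [l']: the kernel condition and
    [f' ∘ l' = id] both hold up to morphisms factoring through [g'], and [g'] kills [b]. *)
Lemma right_extension_exact (A B X : S) (Y : D) (f : hom (sval A) (sval B))
    (g : hom (sval B) (sval X)) (h : hom (sval X) Y) : tri T f g h ->
  forall b : K B, sub_fmap K g b = 0 -> exists a, sub_fmap K f a = b.
Proof.
move=> fgh b gb; have [rinj re rn] := Kr.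
have [Z [z zfg]] := tri_unrot fgh.
have Z1 : lem1 W Z by apply/(weights_shift_le W zfg); exact: svalP.
have iz := proj1 (ge0P W _) (svalP (E A)).2 Z Z1 (i A ∘ z).
have [l lE] := tri_desc zfg iz.
have [l' l'E] := env_extend l (svalP (E A)).2.
have [f' f'E] := env_extend (i B ∘ f) (svalP (E B)).2.
have [g' g'E] := env_extend (i X ∘ g) (svalP (E X)).2.
have g'b : sub_fmap F g' (r B b) = 0 by rewrite -(rn _ _ _ _ g'E) gb raddf0.
have eb := right_extension_ker b.
have /re[a aE] : sub_fmap F (e A) (sub_fmap F l' (r B b)) = 0.
  rewrite -sub_fmap_comp.
  have elf : e A ∘ l ∘ f = 0 by rewrite -homA -lE env_ei.
  have [u uE] := tri_desc fgh elf.
  have [u' u'E] := env_extend u (svalP (R A)).2.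
  rewrite (@env_eq _ _ _ (u' ∘ g')) //; first by rewrite sub_fmap_comp g'b raddf0.
  by rewrite -!homA l'E g'E uE homA u'E.
exists a; apply: rinj; rewrite (rn _ _ _ _ f'E) aE -sub_fmap_comp.
have kf : (f' ∘ l' ∘ i B - i B) ∘ f = 0.
  by rewrite compBl -!homA (homA l') l'E -lE f'E subrr.
have [u uE] := tri_desc fgh kf.
have [u' u'E] := env_extend u (svalP (E B)).2.
rewrite (@env_eq _ _ _ (u' ∘ g' + idm _)) //.
  by rewrite sub_fmapD sub_fmap_comp g'b raddf0 add0r sub_fmap_id.
by rewrite homDl hom1l -(homA u') g'E (homA u') u'E -uE subrK.
Qed.

Definition heart_le0 (X : Hw) : S := exist _ (sval X) (svalP X).1.

(** On an object of the heart [i] has a retraction [s], so [F X] is identified with the kernel that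
    defines [K]. *)
Lemma right_extension_restrict (X : Hw) :
  exists psi : {additive F X -> K (heart_le0 X)}, bijective psi /\
    forall x, r (heart_le0 X) (psi x) = sub_fmap F (i (heart_le0 X)) x.
Proof.
have [rinj re _] := Kr; set Y := heart_le0 X.
have [s sE] := env_extend (idm (sval Y)) (svalP X).2.
have kerP (x : F X) : exists y, r Y y = sub_fmap F (i Y) x.
  by apply/re; rewrite -(sub_fmap_comp (X := X)) (env_ei Y) sub_fmap0.
pose psi x := sval (cid (kerP x)).
have psiE x : r Y (psi x) = sub_fmap F (i Y) x := svalP (cid (kerP x)).
have psiB : zmod_morphism psi by move=> x y; apply: rinj; rewrite raddfB !psiE raddfB.
pose psi' := HB.pack_for {additive F X -> K Y} psi
  (GRing.isZmodMorphism.Build _ _ psi psiB).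
exists psi'; split; last exact: psiE.
exists (fun y => sub_fmap F s (r Y y)) => [x|y] /=.
  by rewrite psiE -sub_fmap_comp sE sub_fmap_id.
apply: rinj; rewrite psiE -sub_fmap_comp -[RHS]sub_fmap_id.
apply: env_eq; first exact: right_extension_ker.
by rewrite -homA sE hom1l hom1r.
Qed.

Section RightExtensionProducts.
Hypothesis products : has_products D.
Hypothesis le0_products : closed_under_products (le0 W).
Hypothesis lem1_products : closed_under_products (lem1 W).

Lemma heart_products : closed_under_products heart.
Proof.
move=> I M P p pP Mh; split.
  by apply: le0_products pP _ => k; exact: (Mh k).1.
apply/(ge0P W) => X X1 f; apply: (product_ext pP) => k; rewrite comp0r.
exact: (proj1 (ge0P W _) (Mh k).2).
Qed.

(** The product of the [L k] has weight at most -1, so [u] vanishes on it, and [product_desc]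
    applies. *)
Lemma product_extend (I : small) (L Y P M : I -> D)
    (l : forall k, hom (L k) (Y k)) (i : forall k, hom (Y k) (P k))
    (h : forall k, hom (P k) (M k)) (PY PP : D) (a : forall k, hom PY (Y k))
    (b : forall k, hom PP (P k)) (G : hom PY PP) :
  (forall k, tri T (l k) (i k) (h k)) -> (forall k, lem1 W (L k)) ->
  is_product a -> is_product b -> (forall k, b k ∘ G = i k ∘ a k) ->
  forall (Q : D) (u : hom PY Q), ge0 W Q -> exists u' : hom PP Q, u' ∘ G = u.
Proof.
move=> lih L1 aP bP GE Q u Q0; have [PL [c cP]] := products L.
have [f fE] := product_lift aP (fun k => l k ∘ c k).
have PL1 : lem1 W PL by apply: lem1_products cP _.
have uf := proj1 (ge0P W Q) Q0 PL PL1 (u ∘ f).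
by have [u' ->] := product_desc lih cP aP bP fE GE uf; exists u'.
Qed.

(** The products [PE] and [PR] of the chosen envelopes, with [G] and [J ∘ Hm], have the extension
    properties of an envelope of [PY] ([extend], [factor]). Comparing them with the chosen envelope
    in both directions, by [s] and [b], identifies the kernels. *)
Lemma right_extension_products : respects_products F -> preserves_products K.
Proof.
move=> /respects_preserves_products Fprod I Y PY pi piP y; have [rinj re rn] := Kr.
have [PE [a aP]] := products (fun k => sval (E (Y k))).
have PEh : heart PE by apply: heart_products aP _ => k; exact: svalP.
pose PE' : Hw := exist _ PE PEh.
have [PM [m mP]] := products (fun k => en_M (env (Y k))).
have [PR [c cP]] := products (fun k => sval (R (Y k))).
have PRh : heart PR by apply: heart_products cP _ => k; exact: svalP.
pose PR' : Hw := exist _ PR PRh.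
have [G GE] := product_lift aP (fun k => i (Y k) ∘ pi k).
have [Hm HE] := product_lift mP (fun k => en_h (env (Y k)) ∘ a k).
have [J JE] := product_lift cP (fun k => en_j (env (Y k)) ∘ m k).
have JHE k : c k ∘ (J ∘ Hm) = e (Y k) ∘ a k.
  by rewrite homA JE -homA HE homA en_eE.
have extend (Q : Hw) (u : hom (sval PY) (sval Q)) :
    exists u' : hom PE (sval Q), u' ∘ G = u.
  apply: (product_extend (fun k => en_tri (env (Y k)))
    (fun k => en_Lm1 (env (Y k))) piP aP GE) => //.
  exact: (svalP Q).2.
have factor (Q : Hw) (u : hom PE (sval Q)) : u ∘ G = 0 ->
    exists u' : hom PR (sval Q), u' ∘ (J ∘ Hm) = u.
  move=> uG.
  (* Descent along [Hm] takes place in the rotated triangles, which start at [Y k]. *)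
  pose trik k := svalP (cid (svalP (cid (tri_rot (en_tri (env (Y k))))))).
  have [v ->] := product_desc trik piP aP mP GE HE uG.
  have [u' <-] := product_extend (fun k => en_tri' (env (Y k)))
    (fun k => en_Nm1 (env (Y k))) mP cP JE v (svalP Q).2.
  by exists u'; rewrite homA.
have [y' [y'E y'U]] := Fprod I (fun k => E (Y k)) PE' a aP
  (fun k => r (Y k) (y k)).
have JHy : sub_fmap F (X := PE') (Y := PR') (J ∘ Hm) y' = 0.
  have [t [_ tU]] := Fprod I (fun k => R (Y k)) PR' c cP
    (fun k => 0).
  rewrite -(tU 0) => [|k]; last by rewrite raddf0.
  apply/esym/tU => k; rewrite -(sub_fmap_comp (X := PE') (Y := PR') (Z := R (Y k))).
  rewrite JHE (sub_fmap_comp (X := PE') (Y := E (Y k)) (Z := R (Y k))).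
  by rewrite y'E right_extension_ker.
have y'zero (Q : Hw) (u : hom PE (sval Q)) : u ∘ G = 0 ->
    sub_fmap F (X := PE') u y' = 0.
  by move=> /factor[u' <-]; rewrite (sub_fmap_comp (X := PE') (Y := PR')) JHy raddf0.
have [s sE] := extend (E PY) (i PY).
have /re[x xE] : sub_fmap F (e PY) (sub_fmap F (X := PE') s y') = 0.
  by rewrite -sub_fmap_comp; apply: y'zero; rewrite -homA sE env_ei.
have pilift k := env_extend (i (Y k) ∘ pi k) (svalP (E (Y k))).2.
pose pi' k := sval (cid (pilift k)).
have pi'E k : pi' k ∘ i PY = i (Y k) ∘ pi k := svalP (cid (pilift k)).
exists x; split=> [k|z zE].
  apply: rinj; rewrite (rn _ _ _ _ (pi'E k)) xE -y'E.
  rewrite -(sub_fmap_comp (X := PE')).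
  apply/eqP; rewrite -subr_eq0 -sub_fmapB; apply/eqP/y'zero.
  by rewrite compBl -homA sE pi'E GE subrr.
have [b bE] := product_lift aP pi'.
apply: rinj; rewrite xE.
have bG : b ∘ i PY = G.
  by apply: (product_ext aP) => k; rewrite homA bE pi'E GE.
have -> : y' = sub_fmap F (Y := PE') b (r PY z).
  apply: y'U => k; rewrite -(sub_fmap_comp (Y := PE')) bE.
  by rewrite -(rn _ _ _ _ (pi'E k)) zE.
rewrite -(sub_fmap_comp (Y := PE')) -[RHS]sub_fmap_id; apply: env_eq.
  exact: right_extension_ker.
by rewrite -homA bG sE hom1l.
Qed.
End RightExtensionProducts.
End RightExtensionProperties.
End RightExtension.
End Heart.

(** * The equivalence of hearts *)

Lemma fully_faithful_equivalent (A B : category) (F : functor A B) :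
  (forall (X Y : A) (f g : arr X Y), fun_arr F f = fun_arr F g -> f = g) ->
  (forall (X Y : A) (g : arr (F X) (F Y)), exists f, fun_arr F f = g) ->
  (forall Y : B, exists (X : A) (d : arr (F X) Y), arr_iso d) ->
  equivalent A B.
Proof.
move=> faith full surj.
pose G0 Y := sval (cid (surj Y)).
pose d Y : arr (F (G0 Y)) Y := sval (cid (svalP (cid (surj Y)))).
have d_iso Y : arr_iso (d Y) := svalP (cid (svalP (cid (surj Y)))).
pose d' Y := sval (cid (d_iso Y)).
have [d'd dd'] : (forall Y, acomp (d' Y) (d Y) = aid _) /\
    (forall Y, acomp (d Y) (d' Y) = aid Y).
  by split=> Y; have [] := svalP (cid (d_iso Y)).
pose pre X Y (g : arr (F X) (F Y)) := sval (cid (full X Y g)).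
have preK X Y (g : arr (F X) (F Y)) : fun_arr F (pre X Y g) = g.
  exact: (svalP (cid (full X Y g))).
pose G1 Y Y' (g : arr Y Y') : arr (G0 Y) (G0 Y') :=
  pre _ _ (acomp (d' Y') (acomp g (d Y))).
have G1id Y : G1 _ _ (aid Y) = aid (G0 Y).
  by apply: faith; rewrite preK fun_id acomp1l d'd.
have G1comp (X Y Z : B) (g : arr Y Z) (f : arr X Y) :
    G1 _ _ (acomp g f) = acomp (G1 _ _ g) (G1 _ _ f).
  apply: faith; rewrite preK fun_comp !preK.
  by rewrite -!acompA; congr (acomp _ (acomp _ _)); rewrite acompA dd' acomp1l.
pose G := @Functor B A G0 G1 G1id G1comp.
exists F, G, (fun X => pre (G0 (F X)) X (d (F X))), d; split=> [X|//|X X' f|Y Y' f].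
- exists (pre X (G0 (F X)) (d' (F X))).
  by split; apply: faith; rewrite fun_comp !preK fun_id.
- apply: faith; rewrite !fun_comp (preK _ X) (preK _ X').
  by rewrite [fun_arr F (fun_arr G _)]preK (acompA (d (F X'))) dd' acomp1l.
- by rewrite [fun_arr G _]/= preK (acompA (d Y')) dd' acomp1l.
Qed.

Section HeartEquivalence.
Variables (D : preadditive) (T : triangulation D) (W : weights T).
Hypothesis brownT : abstract_brown T.
Hypothesis le0_products : closed_under_products (le0 W).
Hypothesis lem1_products : closed_under_products (lem1 W).

Local Notation S := (full_subcat (le0 W)).
Local Notation Hw := (full_subcat (heart W)).
Local Notation Ht := (full_subcat (t_heart_ob W)).
Local Notation E Y := (en_ob (env Y)).

Definition heart_functor (N : D) : ab_functor Hw := ab_restrict (heart W) (hom_functor N).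

Lemma heart_functor_products (N : D) : respects_products (heart_functor N).
Proof.
move=> I M P p pP y.
have hP := heart_products le0_products.
by have := full_subcat_product_conv brownT.1 hP pP; apply.
Qed.

Lemma precomp_morphism (N N' X : D) (f : hom N' N) :
  zmod_morphism ((fun x => x ∘ f) : hom N X -> hom N' X).
Proof. by move=> x y; exact: compBl. Qed.

Definition precomp (N N' X : D) (f : hom N' N) : {additive hom N X -> hom N' X} :=
  HB.pack_for {additive hom N X -> hom N' X} (fun x : hom N X => x ∘ f)
    (GRing.isZmodMorphism.Build _ _ _ (@precomp_morphism N N' X f)).

Definition heart_trans (N N' : D) (f : hom N' N) :
  nat_trans (heart_functor N) (heart_functor N') :=
  @NatTrans Hw (heart_functor N) (heart_functor N')
    (fun X => precomp (sval X) f) (fun X Y g x => esym (homA _ _ _)).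

Definition heart_embedding :
  functor (underlying (opposite Ht)) (product_functors Hw).
Proof.
refine (@Functor (underlying (opposite Ht)) (product_functors Hw)
  (fun N => exist _ (heart_functor (sval N)) (@heart_functor_products (sval N)))
  (fun N N' f => heart_trans (f : @hom D (sval N') (sval N))) _ _).
- by move=> N; apply: nat_trans_ext => X x; exact: hom1r.
- by move=> N1 N2 N3 g f; apply: nat_trans_ext => X x; exact: (@homA D).
Defined.

Lemma t_heart_le0 (N : Ht) : le0 W (sval N).
Proof. exact: (svalP N).1. Qed.

(** A Yoneda argument: [N] need not lie in the heart of the weight structure, so the transformations
    are evaluated at the envelope [N -> E Y] instead of the identity, and [env_mono] cancels it. *)
Lemma heart_embedding_faithful (N N' : Ht) (f g : hom (sval N') (sval N)) :
  heart_trans f = heart_trans g -> f = g.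
Proof.
pose Y : S := exist _ (sval N) (t_heart_le0 N).
move=> /(congr1 (fun a : nat_trans (heart_functor (sval N)) _ =>
  a (E Y) (en_map (env Y)))) /= fg.
apply/eqP; rewrite -subr_eq0; apply/eqP; apply: (@env_mono _ _ _ Y).
  exact: (svalP N').2.
by rewrite compBr; apply/eqP; rewrite subr_eq0; apply/eqP.
Qed.

(** The value of [a] at the envelope of [N] is killed by the differential, by naturality; hence it
    lifts to a morphism [N' -> N]. Every morphism from [N] to the heart factors through the
    envelope, so this lift determines [a]. *)
Lemma heart_embedding_full (N N' : Ht)
    (a : nat_trans (heart_functor (sval N)) (heart_functor (sval N'))) :
  exists f : hom (sval N') (sval N), heart_trans f = a.
Proof.
pose Y : S := exist _ (sval N) (t_heart_le0 N).
pose i : heart_functor (sval N) (E Y) := en_map (env Y).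
have nat (X X' : Hw) (g : hom (sval X) (sval X')) (x : hom (sval N) (sval X)) :
  a X' (g ∘ x) = g ∘ (a X x : hom (sval N') (sval X)) by exact: (@ntP _ _ _ a X X' g x).
have ei : en_e (env Y) ∘ (a (E Y) i : hom (sval N') (sval (E Y))) = 0.
  by rewrite -nat /i (env_ei Y) raddf0.
have [f fE] := env_lift (svalP N').2 ei.
exists f; apply: nat_trans_ext => X x /=.
have [x' <-] := env_extend (x : hom (sval Y) (sval X)) (svalP X).2.
by rewrite -homA fE nat.
Qed.

Lemma heart_embedding_surj (F : ab_functor Hw) : respects_products F ->
  exists N : Ht, nat_iso (heart_functor (sval N)) F.
Proof.
move=> Fprod; have [K [r Kr]] := right_extension_ex F.
have Kprod : preserves_products K.
  exact: (right_extension_products Kr brownT.1).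
have [N N0 [phi [phibij phiE]]] := left_extension_corepresentable brownT
  le0_products (right_extension_exact Kr) Kprod.
have Nh : t_heart_ob W N.
  split=> // Y Y1 f; have Y0 := lem1_le0 Y1.
  apply: (bij_inj (phibij (exist _ Y Y0))).
  by rewrite !(right_extension_lem1 Kr (Y := exist _ Y Y0) Y1 (phi _ _)).
exists (exist _ N Nh).
have [_ _ rn] := Kr; have [rinj _ _] := Kr.
have respex X := right_extension_restrict Kr X.
pose psi X := sval (cid (respex X)).
have [psibij psiE] : (forall X, bijective (psi X)) /\ forall X x,
    r (heart_le0 X) (psi X x) = sub_fmap F (en_map (env (heart_le0 X))) x.
  by split=> X; have [] := svalP (cid (respex X)).
have psinat (X Y : Hw) (f : hom (sval X) (sval Y)) x :
    psi Y (sub_fmap F f x) =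
    sub_fmap K (X := heart_le0 X) (Y := heart_le0 Y) f (psi X x).
  apply: rinj; rewrite psiE.
  have [f' f'E] := env_extend (Y := heart_le0 X)
    (en_map (env (heart_le0 Y)) ∘ f) (svalP (E (heart_le0 Y))).2.
  rewrite (rn _ _ _ _ f'E) psiE -(sub_fmap_comp (Y := Y)) -(sub_fmap_comp (X := X)).
  by rewrite f'E.
pose psi' X := s2val (cid2 (additive_inverse (psibij X))).
have psiK X : cancel (psi X) (psi' X) := s2valP (cid2 (additive_inverse (psibij X))).
have psi'K X : cancel (psi' X) (psi X) := s2valP' (cid2 (additive_inverse (psibij X))).
pose b (X : Hw) : {additive heart_functor N X -> F X} := psi' X \o phi (heart_le0 X).
have bnat (X Y : Hw) (f : @hom Hw X Y) x :
    b Y (fmap (heart_functor N) f x) = fmap F f (b X x).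
  apply: (can_inj (psiK Y)).
  rewrite [RHS](psinat X Y f) /b /= !psi'K.
  exact: (phiE (heart_le0 X) (heart_le0 Y) f).
exists (NatTrans bnat) => X.
have psi'bij : bijective (psi' X) by exists (psi X).
exact: (bij_comp psi'bij (phibij (heart_le0 X))).
Qed.

Lemma heart_equivalent :
  equivalent (underlying (opposite Ht)) (product_functors Hw).
Proof.
apply: (fully_faithful_equivalent (F := heart_embedding)).
- by move=> N N' f g; exact: heart_embedding_faithful.
- by move=> N N' a; exact: heart_embedding_full.
- move=> [F Fprod]; have [N [a abij]] := heart_embedding_surj Fprod.
  by exists N, a; exact: nat_iso_inverse abij.
Qed.

End HeartEquivalence.

(** * Triangulated categories and their opposites *)

Section Isomorphisms.
Variable D : preadditive.

Lemma iso_refl (X : D) : isomorphic X X.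
Proof. by exists (idm X), (idm X); rewrite hom1l. Qed.

Lemma iso_sym (X Y : D) : isomorphic X Y -> isomorphic Y X.
Proof. by move=> [f [g [gf fg]]]; exists g, f. Qed.

Lemma is_iso_id (X : D) : is_iso (idm X).
Proof. by exists (idm X); rewrite hom1l. Qed.

Lemma iso_trans (X Y Z : D) : isomorphic X Y -> isomorphic Y Z -> isomorphic X Z.
Proof.
move=> [f [f' [f'f ff']]] [g [g' [g'g gg']]]; exists (g ∘ f), (f' ∘ g'); split.
  by rewrite -homA (homA g') g'g hom1l.
by rewrite -homA (homA f) ff' hom1l.
Qed.

Definition hom0 (X Y : D) : Prop := forall f : hom X Y, f = 0.

Lemma hom0_iso (X X' Y Y' : D) : isomorphic X X' -> isomorphic Y Y' ->
  hom0 X Y -> hom0 X' Y'.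
Proof.
move=> [a [a' [_ aa']]] [b [b' [_ bb']]] XY f.
rewrite -(hom1r f) -aa' -(hom1l (f ∘ _)) -bb' -(homA b) !(homA b') (homA (b' ∘ f)).
by rewrite (XY (b' ∘ f ∘ a)) comp0l comp0r.
Qed.

End Isomorphisms.

Section Shift.
Variable C : triangulated.

Lemma shm_inj (X Y : C) : injective (@shm C X Y).
Proof. exact: bij_inj (shm_bij X Y). Qed.

Lemma shm_surj (X Y : C) (g : hom (sh X) (sh Y)) : exists f, shm f = g.
Proof. by have [k _ kK] := shm_bij X Y; exists (k g). Qed.

Lemma hom0_sh (X Y : C) : hom0 (sh X) (sh Y) <-> hom0 X Y.
Proof.
split=> XY f; first by apply: shm_inj; rewrite raddf0.
by have [g <-] := shm_surj f; rewrite (XY g) raddf0.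
Qed.

Lemma iso_sh (X Y : C) : isomorphic (sh X) (sh Y) <-> isomorphic X Y.
Proof.
split=> [[f [g [gf fg]]]|[f [g [gf fg]]]].
  have [f' f'E] := shm_surj f; have [g' g'E] := shm_surj g.
  by exists f', g'; split; apply: shm_inj; rewrite shm_comp f'E g'E shm_id.
by exists (shm f), (shm g); rewrite -!shm_comp gf fg !shm_id.
Qed.

Lemma dist_desc (X Y Z : C) (f : hom X Y) (g : hom Y Z) (h : hom Z (sh X)) :
  dist f g h -> forall (V : C) (k : hom Y V), k ∘ f = 0 ->
  exists k' : hom Z V, k = k' ∘ g.
Proof.
move=> fgh V k kf; have [O O0] := zero_ex C.
have [c [cg _]] := dist_fill (a := 0 : hom X O) (b := k) fgh (dist_0id V O0)
  (etrans kf (esym (comp0r _ _))).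
by exists c; rewrite cg hom1l.
Qed.

Lemma dist_lift (X Y Z : C) (f : hom X Y) (g : hom Y Z) (h : hom Z (sh X)) :
  dist f g h -> forall (V : C) (k : hom V Y), g ∘ k = 0 ->
  exists k' : hom V X, k = f ∘ k'.
Proof.
move=> fgh V k gk; have [O O0] := zero_ex C.
have [c [_]] := dist_fill (a := k) (b := 0 : hom O Z)
  ((dist_rot _ _ _).1 (dist_id V O0)) ((dist_rot _ _ _).1 fgh)
  (etrans (comp0l _ _) (esym gk)).
have [c' <-] := shm_surj c.
rewrite compNr compNl -!shm_comp hom1r => /oppr_inj/shm_inj kE.
by exists c'.
Qed.

Lemma dist_last (X A : C) (h : hom A (sh X)) :
  exists (U : C) (j : hom X U) (i : hom U A), dist j i h.
Proof.
have [V [p [q hpq]]] := dist_cone h.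
have [U [s [s' [s's ss']]]] := sh_esssurj V.
have [j jE] := shm_surj (- (s' ∘ p)); have [i iE] := shm_surj (- (q ∘ s)).
exists U, j, i; apply/dist_rot/dist_rot; rewrite iE jE !opprK.
apply: (dist_iso (is_iso_id A) (is_iso_id (sh X)) (c := s')) hpq.
- by exists s.
- by rewrite hom1l hom1r.
- by rewrite hom1r.
- by rewrite shm_id hom1l -homA ss' hom1r.
Qed.

Lemma dist_unshift (X Y Z : C) (f : hom X Y) (g : hom Y Z)
    (h : hom (sh Z) (sh (sh X))) :
  dist (shm f) (shm g) h -> exists h' : hom Z (sh X), dist f g h'.
Proof.
(* Three rotations turn ([f], [g], [- h']) into ([- shm f], [- shm g], [shm h']); the sign change on
   the middle object removes the first two signs. *)
have [h' <-] := shm_surj h => fgh; exists (- h').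
do 3 apply/dist_rot.
apply: (dist_iso (is_iso_id _) (b := - idm _) _ (is_iso_id _)) fgh.
- by exists (- idm _); rewrite compNl compNr opprK hom1l.
- by rewrite compNl hom1l hom1r.
- by rewrite hom1l compNr compNl opprK hom1r.
- by rewrite shm_id hom1l hom1r raddfN opprK.
Qed.

Definition ctri (A B X Y : C) (f : hom A B) (g : hom B X) (h : hom X Y) : Prop :=
  exists (h' : hom X (sh A)) (e : hom (sh A) Y),
  [/\ is_iso e, dist f g h' & h = e ∘ h'].

Lemma dist_ctri (X Y Z : C) (f : hom X Y) (g : hom Y Z) (h : hom Z (sh X)) :
  dist f g h -> ctri f g h.
Proof. by move=> fgh; exists h, (idm _); split; rewrite ?hom1l //; exact: is_iso_id. Qed.

Lemma ctri_rot (A B X Y : C) (f : hom A B) (g : hom B X) (h : hom X Y) :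
  ctri f g h -> exists (Z : C) (k : hom Y Z), ctri g h k.
Proof.
move=> [h' [e [[e' [e'e ee']] fgh' ->]]].
exists (sh B), (- shm f ∘ e'); apply: dist_ctri.
apply: (dist_iso (is_iso_id B) (is_iso_id X) (c := e)) ((dist_rot _ _ _).1 fgh').
- by exists e'.
- by rewrite hom1l hom1r.
- by rewrite hom1r.
- by rewrite shm_id hom1l -homA e'e hom1r.
Qed.

Lemma ctri_unrot (A B X Y : C) (f : hom A B) (g : hom B X) (h : hom X Y) :
  ctri f g h -> exists (Z : C) (k : hom Z A), ctri k f g.
Proof.
move=> [h' [_ [_ fgh' _]]].
have [Z [s [s' [s's ss']]]] := sh_esssurj X.
have [k kE] := shm_surj (- (h' ∘ s)).
exists Z, k, (s' ∘ g), s; split; [by exists s'| |by rewrite homA ss' hom1l].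
apply/dist_rot; rewrite kE opprK.
apply: (dist_iso (is_iso_id A) (is_iso_id B) (c := s')) fgh'.
- by exists s.
- by rewrite hom1l hom1r.
- by rewrite hom1r.
- by rewrite shm_id hom1l -homA ss' hom1r.
Qed.

Lemma dist_shm0 (X Y Z : C) (f : hom X Y) (g : hom Y Z) (h : hom Z (sh X)) :
  dist f g h -> shm f ∘ h = 0.
Proof.
move=> /dist_rot/dist_rot/dist_comp0; rewrite compNl => /eqP.
by rewrite oppr_eq0 => /eqP.
Qed.

Lemma ctri_shift (Z B M A : C) (z : hom Z B) (b : hom B M) (a : hom M A) :
  ctri z b a -> forall (X : C) (x : hom B X),
  exists (U Y : C) (j : hom X U) (i : hom U A) (y : hom A Y),
    [/\ ctri j i y, y ∘ a = 0 & y = 0 -> x ∘ z = 0].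
Proof.
move=> [a' [e [[e' [e'e ee']] zba' ->]]] X x.
have [U [j [i jiy]]] := dist_last (shm (x ∘ z) ∘ e').
exists U, (sh X), j, i, (shm (x ∘ z) ∘ e'); split; first exact: dist_ctri.
  by rewrite -homA (homA e') e'e hom1l shm_comp -homA (dist_shm0 zba') comp0r.
move=> y0; apply: shm_inj; rewrite raddf0.
by rewrite -(hom1r (shm _)) -e'e homA y0 comp0l.
Qed.

(** [ctri_shift] for the opposite category: the extension of [X] by [A] has as its connecting
    morphism [y], the desuspension of [z' ∘ x]. *)
Lemma ctri_coshift (A M B Z : C) (a : hom A M) (b : hom M B) (z : hom B Z) :
  ctri a b z -> forall (X : C) (x : hom X B),
  exists (U Y : C) (j : hom U X) (i : hom A U) (y : hom Y A),
    [/\ ctri y i j, a ∘ y = 0 & y = 0 -> z ∘ x = 0].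
Proof.
move=> [z' [e [_ abz' ->]]] X x.
have [Y [s [s' [s's ss']]]] := sh_esssurj X.
have [y yE] := shm_surj (z' ∘ x ∘ s).
have [U [i [j yij]]] := dist_cone y.
exists U, Y, (s ∘ j), i, y; split.
- by exists j, s; split=> //; exists s'.
- apply: shm_inj; rewrite shm_comp yE raddf0 !homA (dist_shm0 abz').
  by rewrite !comp0l.
- move=> y0; suff z'x : z' ∘ x = 0 by rewrite -homA z'x comp0r.
  by rewrite -(hom1r (z' ∘ x)) -ss' homA -yE y0 raddf0 comp0l.
Qed.

Definition triangulation_of : triangulation C.
Proof.
exists ctri.
- exact: biproduct_ex.
- by move=> A B X Y f g h [h' [e [_ /dist_comp0]]].
- by move=> A B X Y f g h [h' [e [_ /dist_desc]]] + _; apply.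
- by move=> A B X Y f g h [h' [e [_ /dist_lift]]] + _; apply.
- move=> A B f; have [X [g [h fgh]]] := dist_cone f.
  by exists X, (sh A), g, h; exact: dist_ctri.
- exact: ctri_rot.
- exact: ctri_unrot.
- exact: ctri_shift.
Defined.

Definition op_triangulation_of : triangulation (opposite C).
Proof.
exists (fun (A B X Y : opposite C) f g h => @ctri Y X B A h g f).
- move=> X Y; have [P [i [j [p [q [pi qj pj qi ij]]]]]] := @biproduct_ex C X Y.
  by exists P, p, q, i, j.
- by move=> A B X Y f g h; exact: (@tri_comp0' _ triangulation_of).
- move=> A B X Y f g h fgh V k.
  exact: (@tri_lift' _ triangulation_of _ _ _ _ _ _ _ fgh).
- move=> A B X Y f g h fgh V k.
  exact: (@tri_desc' _ triangulation_of _ _ _ _ _ _ _ fgh).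
- move=> A B f.
  have [X [Y [g [h fgh]]]] := @tri_fiber _ triangulation_of B A f.
  have [Z [k kgf]] := ctri_unrot fgh.
  by exists X, Z, g, k.
- by move=> A B X Y f g h; exact: ctri_unrot.
- by move=> A B X Y f g h; exact: ctri_rot.
- by move=> Z B M A z b a; exact: ctri_coshift.
Defined.

End Shift.

(** * Weight structures *)

Section WeightStructure.
Variables (C : triangulated) (w : weight_structure C).

Lemma retracts_isos (D : preadditive) (A : D -> Prop) :
  closed_under_retracts A -> closed_under_isos A.
Proof. by move=> Ar X Y [f [g [_ fg]]]; exact: Ar fg. Qed.

Lemma shift_iso (A : C -> Prop) : closed_under_isos (shift A).
Proof. by move=> X Y XY [Z AZ ZX]; exists Z => //; exact: iso_trans ZX XY. Qed.

Lemma sh_shift (A : C -> Prop) (X : C) : A X -> shift A (sh X).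
Proof. by exists X => //; exact: iso_refl. Qed.

Lemma shift_sh (A : C -> Prop) (X : C) :
  closed_under_isos A -> shift A (sh X) -> A X.
Proof. by move=> Ai [Y AY /iso_sh YX]; exact: Ai YX AY. Qed.

Lemma shift_retract (A : C -> Prop) :
  closed_under_retracts A -> closed_under_retracts (shift A).
Proof.
move=> Ar X Y i r ri [Y' AY' [s [s' [s's ss']]]].
have [X' [t [t' [t't tt']]]] := sh_esssurj X; exists X'; last by exists t, t'.
have [i' i'E] := shm_surj (s' ∘ i ∘ t); have [r' r'E] := shm_surj (t' ∘ r ∘ s).
apply: (Ar _ _ i' r') => //; apply: shm_inj.
rewrite shm_comp i'E r'E shm_id -!homA (homA s) ss' hom1l.
by rewrite (homA r) ri hom1l t't.
Qed.

Lemma w_le_iso : closed_under_isos (w_le w).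
Proof. exact: retracts_isos (@w_le_retract _ w). Qed.

Lemma w_ge_iso : closed_under_isos (w_ge w).
Proof. exact: retracts_isos (@w_ge_retract _ w). Qed.

Lemma w_leP X : w_le w X <-> forall Y, shift (w_ge w) Y -> hom0 X Y.
Proof.
split=> [X0 Y Y1 f|X0]; first exact: w_perp X0 Y1.
have [L [R [f [g [h [L0 R1 fgh]]]]]] := w_decomp w X.
have gX : g ∘ idm X = 0 by rewrite (X0 _ R1 g) comp0l.
have [r rE] := dist_lift fgh gX.
exact: w_le_retract (esym rE) L0.
Qed.

Lemma w_ge1P Y : shift (w_ge w) Y <-> forall X, w_le w X -> hom0 X Y.
Proof.
split=> [Y1 X X0 f|Y1]; first exact: w_perp X0 Y1.
have [L [R [f [g [h [L0 R1 fgh]]]]]] := w_decomp w Y.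
have Yf : idm Y ∘ f = 0 by rewrite (Y1 _ L0 f) comp0r.
have [r rE] := dist_desc fgh Yf.
exact: (shift_retract (@w_ge_retract _ w)) (esym rE) R1.
Qed.

Lemma w_lem1P X : w_le w (sh X) <-> forall Y, w_ge w Y -> hom0 X Y.
Proof.
rewrite w_leP; split=> X0 Y Y0.
  by apply/hom0_sh/X0/sh_shift.
have [Y' Y'0 Y'Y] := Y0.
by apply: (hom0_iso (iso_refl _) Y'Y); apply/hom0_sh/X0.
Qed.

Lemma w_geP Y : w_ge w Y <-> forall X, w_le w (sh X) -> hom0 X Y.
Proof.
split=> [Y0 X /w_lem1P|Y0]; first exact.
apply: shift_sh; first exact: w_ge_iso.
apply/w_ge1P => X X0; have [X' X'X] := sh_esssurj X.
apply: (hom0_iso X'X (iso_refl _)); apply/hom0_sh/Y0.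
by apply: w_le_iso X0; exact: iso_sym.
Qed.

Lemma w_lem1_le X : w_le w (sh X) -> w_le w X.
Proof. by move=> /w_le_shift/shift_sh; apply; exact: w_le_iso. Qed.

Lemma ctri_iso (A B X Y : C) (f : hom A B) (g : hom B X) (h : hom X Y) :
  ctri f g h -> isomorphic (sh A) Y.
Proof. by move=> [h' [e [? ? ?]]]; exists e. Qed.

Lemma ctri_ge (A B X Y : C) (f : hom A B) (g : hom B X) (h : hom X Y) :
  ctri f g h -> w_ge w A <-> shift (w_ge w) Y.
Proof.
move=> /ctri_iso AY; split=> [A0|]; first by exists A.
move/(shift_iso (iso_sym AY))/shift_sh; apply; exact: w_ge_iso.
Qed.

Lemma ctri_le (A B X Y : C) (f : hom A B) (g : hom B X) (h : hom X Y) :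
  ctri f g h -> w_le w (sh A) <-> w_le w Y.
Proof. by move=> /ctri_iso AY; split; apply: w_le_iso => //; exact: iso_sym. Qed.

(** The decomposition of [sh M], desuspended. *)
Lemma w_decompm1 (M : C) : exists (L R Y : C) (f : hom L M) (g : hom M R)
  (h : hom R Y), [/\ w_le w (sh L), w_ge w R & ctri f g h].
Proof.
have [L' [R' [f' [g' [h' [L0 R1 fgh]]]]]] := w_decomp w (sh M).
have [L [s [s' [s's ss']]]] := sh_esssurj L'.
have [R R0 [t [t' [t't tt']]]] := R1.
have [f fE] := shm_surj (f' ∘ s); have [g gE] := shm_surj (t' ∘ g').
have [|h fgh'] := @dist_unshift _ _ _ _ f g (shm s' ∘ h' ∘ t).
  apply: (dist_iso (a := s') (c := t') _ (is_iso_id _) _) fgh.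
  - by exists s.
  - by exists t.
  - by rewrite fE hom1l -homA ss' hom1r.
  - by rewrite gE hom1r.
  - by rewrite -homA tt' hom1r.
exists L, R, (sh L), f, g, h; split=> //; last exact: dist_ctri.
by apply: w_le_iso L0; exists s', s.
Qed.

Definition weights_of : weights (triangulation_of C).
Proof.
exists (w_le w) (fun X => w_le w (sh X)) (w_ge w) (shift (w_ge w)).
- exact: w_leP.
- exact: w_ge1P.
- exact: w_lem1P.
- exact: w_geP.
- exact: w_lem1_le.
- move=> M; have [L [R [f [g [h [L0 R1 fgh]]]]]] := w_decomp w M.
  by exists L, R, (sh L), f, g, h; split=> //; exact: dist_ctri.
- exact: w_decompm1.
- exact: ctri_ge.
- exact: ctri_le.
Defined.

(** The opposite category negates weights, so the class [le0] is [w_ge w] and [ge0] is [w_le w]. *)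
Definition op_weights_of : weights (op_triangulation_of C).
Proof.
exists (w_ge w : opposite C -> Prop) (shift (w_ge w)) (w_le w) (fun X => w_le w (sh X)).
- exact: w_geP.
- exact: w_lem1P.
- exact: w_ge1P.
- exact: w_leP.
- exact: w_ge_shift.
- move=> M; have [L [R [Y [f [g [h [L0 R1 fgh]]]]]]] := w_decompm1 M.
  by have [Z [k kfg]] := ctri_unrot fgh; exists R, L, Z, g, f, k.
- move=> M; have [L [R [f [g [h [L0 R1 /dist_ctri fgh]]]]]] := w_decomp w M.
  by have [Z [k kfg]] := ctri_unrot fgh; exists R, L, Z, g, f, k.
- by move=> A B X Y f g h fgh; exact: iff_sym (ctri_le fgh).
- by move=> A B X Y f g h fgh; exact: iff_sym (ctri_ge fgh).
Defined.

End WeightStructure.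

(** * Products, coproducts and the shift *)

Section FullyFaithfulProducts.
Variables (D : preadditive) (s : D -> D) (m : forall X Y, hom X Y -> hom (s X) (s Y)).
Hypothesis m_comp : forall (X Y Z : D) (g : hom Y Z) (f : hom X Y),
  m (g ∘ f) = m g ∘ m f.
Hypothesis m_bij : forall X Y, bijective (@m X Y).
Hypothesis s_esssurj : forall Y, exists X, isomorphic (s X) Y.

Lemma fully_faithful_product (I : small) (M : I -> D) (P : D)
    (p : forall k, hom P (M k)) :
  is_product p -> is_product (fun k => m (p k)).
Proof.
move=> pP N f; have [N' [a [a' [a'a aa']]]] := s_esssurj N.
have surj X Y (g : hom (s X) (s Y)) : exists f, m f = g.
  by have [k _ kK] := m_bij X Y; exists (k g).
have fex k := surj _ _ (f k ∘ a).
have [g gE] := product_lift pP (fun k => sval (cid (fex k))).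
have gE' k : m (p k) ∘ m g = f k ∘ a by rewrite -m_comp gE; case: cid.
exists (m g ∘ a'); split=> [k|h hE].
  by rewrite homA gE' -homA aa' hom1r.
have [h' h'E] := surj _ _ (h ∘ a).
suff -> : g = h' by rewrite h'E -homA aa' hom1r.
apply: (product_ext pP) => k; apply: (bij_inj (m_bij _ _)).
by rewrite !m_comp gE' h'E homA hE.
Qed.
End FullyFaithfulProducts.

Section ShiftProducts.
Variable C : triangulated.

Lemma sh_product (I : small) (M : I -> C) (P : C) (p : forall k, hom P (M k)) :
  is_product p -> is_product (fun k => shm (p k)).
Proof.
apply: (fully_faithful_product (m := fun X Y => @shm C X Y)).
- exact: shm_comp.
- exact: shm_bij.
- exact: sh_esssurj.
Qed.

Lemma sh_coproduct (I : small) (M : I -> C) (P : C) (p : forall k, hom (M k) P) :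
  is_coproduct p -> is_coproduct (fun k => shm (p k)).
Proof.
apply: (@fully_faithful_product (opposite C) (@sh C) (fun X Y => @shm C Y X)).
- by move=> X Y Z g f; exact: shm_comp.
- by move=> X Y; exact: shm_bij.
- by move=> Y; have [X /iso_sym [f [g [? ?]]]] := sh_esssurj Y; exists X, f, g.
Qed.

Lemma product_iso (D : preadditive) (I : small) (M N : I -> D) (P : D)
    (p : forall k, hom P (M k)) (a : forall k, hom (M k) (N k)) :
  (forall k, is_iso (a k)) -> is_product p -> is_product (fun k => a k ∘ p k).
Proof.
move=> aiso pP X f; pose b k := sval (cid (aiso k)).
have [ba ab] : (forall k, b k ∘ a k = idm _) /\ (forall k, a k ∘ b k = idm _).
  by split=> k; have [] := svalP (cid (aiso k)).
have [g gE] := product_lift pP (fun k => b k ∘ f k).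
exists g; split=> [k|h hE]; first by rewrite -homA gE homA ab hom1l.
by apply: (product_ext pP) => k; rewrite gE -hE homA homA ba hom1l.
Qed.

Lemma shift_coproducts (A : C -> Prop) :
  has_coproducts C -> closed_under_coproducts A ->
  closed_under_coproducts (shift A).
Proof.
move=> hC Ac I M P i iP AM.
pose N k := s2val (cid2 (AM k)).
have AN k : A (N k) := s2valP (cid2 (AM k)).
have NM k : isomorphic (sh (N k)) (M k) := s2valP' (cid2 (AM k)).
pose a k := sval (cid (NM k)).
have aiso k : is_iso (a k) := svalP (cid (NM k)).
have [Q [j jP]] := hC I N.
exists Q; first exact: Ac jP AN.
have iP' : @is_coproduct C I (fun k => sh (N k)) P
    (fun k => @mcomp C (sh (N k)) (M k) P (i k) (a k)).
  apply: (@product_iso (opposite C) I M (fun k => sh (N k)) P i a _ iP) => k.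
  by have [b [? ?]] := aiso k; exists b.
have [f [g [gf fg _ _]]] := product_unique (sh_coproduct jP) iP'.
by exists g, f.
Qed.

Lemma sh_le_products (A : C -> Prop) : closed_under_products A ->
  closed_under_products (fun X => A (sh X)).
Proof. by move=> Ap I M P p pP AM; exact: Ap (sh_product pP) AM. Qed.
End ShiftProducts.

(** * Orthogonality for t-structures *)

Section TStructure.
Variables (C : triangulated) (t : t_structure C).

Lemma dist_desuspend (X Y Z : C) (f : hom X Y) (g : hom Y Z) (h : hom Z (sh X)) :
  dist f g h -> exists (V : C) (k : hom V X),
  isomorphic (sh V) Z /\ forall (T : C) (l : hom T X), f ∘ l = 0 ->
    exists l', l = k ∘ l'.
Proof.
move=> /dist_ctri /ctri_unrot[V [k kfg]]; exists V, k.
split; first exact: ctri_iso kfg.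
exact: (@tri_lift _ (triangulation_of C) _ _ _ _ _ _ _ kfg).
Qed.

Lemma t_ge_hom0 X Y : t_ge t X -> unshift (t_le t) Y -> hom0 X Y.
Proof.
move=> X0 [Z Z0 ZY]; apply/hom0_sh; apply: (hom0_iso (iso_refl _) ZY) => f.
by apply: (@t_perp _ t) => //; exact: sh_shift.
Qed.

(** The classes are only closed under isomorphisms, so exhibiting [X] as a retract of [L] would not
    suffice: [f] is shown to be invertible. Orthogonality gives [R = 0], a section [r] of [f], and
    [r ∘ f = id] since the difference factors through the desuspension of [R]. *)
Lemma t_geP X : t_ge t X <-> forall Y, unshift (t_le t) Y -> hom0 X Y.
Proof.
split=> [X0 Y|X0]; first exact: t_ge_hom0.
have [L [R [f [g [h [L0 R0 fgh]]]]]] := t_decomp t X.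
have g0 : g = 0 := X0 _ R0 g.
have gX : g ∘ idm X = 0 by rewrite g0 comp0l.
have Rg : idm R ∘ g = 0 by rewrite g0 comp0r.
have R0id : idm R = 0.
  have [k ->] := dist_desc ((dist_rot _ _ _).1 fgh) Rg.
  by rewrite (t_ge_hom0 (t_ge_shift (sh_shift L0)) R0 k) comp0l.
have [V [k [VR kP]]] := dist_desuspend fgh.
have V0 (l : hom L V) : l = 0.
  apply: shm_inj; rewrite raddf0.
  apply: (hom0_iso (iso_refl _) (iso_sym VR)) => u.
  by rewrite -(hom1l u) R0id comp0l.
have [r rE] := dist_lift fgh gX.
have frf : f ∘ (r ∘ f - idm L) = 0 by rewrite compBr homA -rE hom1l hom1r subrr.
have [l lE] := kP _ _ frf.
apply: t_ge_iso L0; exists f, r; split; last by rewrite -rE.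
by apply/eqP; rewrite -subr_eq0 lE (V0 l) comp0r.
Qed.

Lemma t_leP Y : t_le t Y <-> forall X, shift (t_ge t) X -> hom0 X Y.
Proof.
split=> [Y0 X X1 f|Y0]; first exact: t_perp X1 Y0.
(* The desuspension of [Y] is decomposed, because it is [sh R] rather than [R] that lies in
   [t_le]. *)
have [M MY] := sh_esssurj Y.
have [L [R [f [g [h [L0 R0 fgh]]]]]] := t_decomp t M.
have f0 : f = 0.
  move: f {fgh}; apply/hom0_sh; apply: (hom0_iso (iso_refl _) (iso_sym MY)).
  exact/Y0/sh_shift.
have [V [k [VR kP]]] := dist_desuspend fgh.
have LV : hom0 L V.
  apply/hom0_sh; apply: (hom0_iso (iso_refl _) (iso_sym VR)).
  exact: t_ge_hom0 (t_ge_shift (sh_shift L0)) R0.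
have fL : f ∘ idm L = 0 by rewrite f0 comp0l.
have L0id : idm L = 0 by have [l ->] := kP _ _ fL; rewrite (LV l) comp0r.
have Mf : idm M ∘ f = 0 by rewrite f0 comp0r.
have [r rE] := dist_desc fgh Mf.
have grg : (g ∘ r - idm R) ∘ g = 0 by rewrite compBl -homA -rE hom1l hom1r subrr.
have [l lE] := dist_desc ((dist_rot _ _ _).1 fgh) grg.
have gr : g ∘ r = idm R.
  apply/eqP; rewrite -subr_eq0 lE -(hom1r l) -shm_id L0id raddf0.
  by rewrite comp0r comp0l.
have [R' R'0 R'R] := R0; apply: t_le_iso R'0.
apply: iso_trans R'R (iso_trans _ MY); apply/iso_sh; exists r, g.
by split.
Qed.
End TStructure.

(** * Adjoint t-structures *)

Lemma perp_products (D : preadditive) (A B : D -> Prop) :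
  (forall Y, B Y <-> forall X, A X -> hom0 X Y) -> closed_under_products B.
Proof.
move=> BP I M P p pP BM; apply/BP => X AX f.
by apply: (product_ext pP) => k; rewrite comp0r; exact: (proj1 (BP _) (BM k)).
Qed.

Lemma perp_coproducts (D : preadditive) (A B : D -> Prop) :
  (forall X, A X <-> forall Y, B Y -> hom0 X Y) -> closed_under_coproducts A.
Proof. by move=> AP; apply: (@perp_products (opposite D) B A) => Y; exact: AP. Qed.

(** The two sides differ only in the proof of associativity. The equality is used for the right
    adjacent heart, which arises inside the opposite category. *)
Lemma underlying_opK (D : preadditive) :
  underlying (opposite (opposite D)) = underlying D.
Proof.
rewrite /underlying /=; congr Category; exact: Prop_irrelevance.
Qed.

(** * The right adjacent t-structure *)

Section RightAdjoint.
Variables (C : triangulated) (w : weight_structure C).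

Lemma brown_op : brown C -> abstract_brown (op_triangulation_of C).
Proof.
move=> [hC hF]; split=> [|F Fex Fprod]; first exact: hC.
apply: hF => // X Y Z f g h fgh y; split=> [fy|[z <-]].
  have [V [k kfg]] := ctri_unrot (dist_ctri fgh).
  exact: (Fex Z Y X V g f k kfg y fy).
have := @fmap_comp (opposite C) F Z Y X f g z => <-.
by rewrite /= (dist_comp0 fgh); exact: (@fmap0 (opposite C)).
Qed.

Lemma right_adjoint_exists : brown C -> w_smashing w ->
  exists t : t_structure C, right_adjacent t w.
Proof.
move=> bC [_ wc].
pose tle (Y : C) := forall X, shift (w_ge w) X -> hom0 X Y.
have tle_iso : closed_under_isos tle.
  by move=> X Y XY X0 Z Z1; exact: hom0_iso (iso_refl _) XY (X0 Z Z1).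
unshelve eexists (@TStructure C tle (w_ge w) tle_iso (@w_ge_iso _ w) _ _ _ _) => //.
- move=> X X0; have [X' X'X] := sh_esssurj X; exists X' => // Z Z1.
  apply/hom0_sh; apply: (hom0_iso (iso_refl _) (iso_sym X'X)); apply: X0.
  by apply: sh_shift; exact: w_ge_shift.
- exact: w_ge_shift.
- by move=> X Y f X1 Y0; exact: Y0.
- move=> M.
  (* Read in [C], the triangle is [A -> M -> B] with [A] in [w_ge], and every morphism from [w_ge]
     to [B] is zero. *)
  have [B [A [Y [b [a [h [bah A0 B0]]]]]]] := @le0_truncation _ _ (brown_op bC)
    (op_weights_of w) wc M.
  have [Z [k abk]] := ctri_rot bah.
  have [h' [_ [_ abh' _]]] := abk.
  exists A, B, a, b, h'; split=> //; exists (sh B); last exact: iso_refl.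
  move=> X [X' X'0 X'X]; apply: (hom0_iso X'X (iso_refl _)); apply/hom0_sh.
  exact: B0.
Qed.

(** [w_ge w] equals [t_ge t], which is a left orthogonal class and hence closed under coproducts. *)
Lemma right_adjoint_smashing (t : t_structure C) : brown C ->
  right_adjacent t w -> w_smashing w.
Proof.
move=> [hC _] tw; split=> //; apply: perp_coproducts => X.
by rewrite -(tw X); exact: t_geP.
Qed.

Lemma right_adjoint_heart (t : t_structure C) : brown C -> right_adjacent t w ->
  t_cosmashing t /\
  equivalent (underlying (t_heart t)) (product_functors (opposite (w_heart w))).
Proof.
move=> bC tw; have [hC wc] := right_adjoint_smashing bC tw; split.
  split; first exact: (brown_coproducts (brown_op bC)).
  apply: (perp_products (A := fun X => w_le w (sh X))) => Y.
  by rewrite (tw Y); exact: w_geP.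
have := @heart_equivalent _ _ (op_weights_of w) (brown_op bC) wc
  (shift_coproducts hC wc).
have -> : t_heart_ob (op_weights_of w) = (fun X => t_le t X /\ t_ge t X).
  apply/predeqP => X; split=> -[X0 X1].
    split; last exact/tw.
    apply/t_leP => Y [Y' Y'0 Y'Y] f; apply: (X1 Y); exists Y' => //; exact/tw.
  split; first exact/tw.
  move=> Y [Y' Y'0 Y'Y] f; apply: (proj1 (t_leP t X) X0 Y); exists Y' => //; exact/tw.
have -> : heart (op_weights_of w) = (fun X => w_le w X /\ w_ge w X).
  by apply/predeqP => X; split=> -[].
by rewrite -(underlying_opK (t_heart t)).
Qed.
End RightAdjoint.

(** * The left adjacent t-structure *)

Section LeftAdjoint.
Variables (C : triangulated) (w : weight_structure C).

Lemma dual_brown_abstract : dual_brown C -> abstract_brown (triangulation_of C).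
Proof.
move=> [hC hF]; split=> // F Fex Fprod.
apply: hF => // X Y Z f g h fgh y; split=> [|[x <-]].
  exact: (Fex _ _ _ _ f g h (dist_ctri fgh)).
by rewrite -fmap_comp (dist_comp0 fgh) fmap0.
Qed.

Lemma left_adjoint_exists : w_cosmashing w -> dual_brown C ->
  exists t : t_structure C, left_adjacent t w.
Proof.
move=> [_ wc] bC.
pose tge (X : C) := forall Y, w_le w (sh Y) -> hom0 X Y.
have tge_iso : closed_under_isos tge.
  by move=> X Y XY X0 Z Z1; exact: hom0_iso XY (iso_refl _) (X0 Z Z1).
unshelve eexists (@TStructure C (w_le w) tge (@w_le_iso _ w) tge_iso _ _ _ _) => //.
- exact: w_le_shift.
- move=> X [X' X'0 X'X] Y Y1; have [Y' Y'Y] := sh_esssurj Y.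
  apply: (hom0_iso X'X Y'Y); apply/hom0_sh/X'0.
  by apply: w_le_iso (w_lem1_le Y1); exact: iso_sym.
- move=> X Y f [X' X'0 X'X] Y0; have [Y' Y'Y] := sh_esssurj Y.
  move: f; apply: (hom0_iso X'X Y'Y); apply/hom0_sh/X'0.
  by apply: w_le_iso Y0; exact: iso_sym.
- move=> M.
  (* The right term of the decomposition of [M] must lie in weight at most -1; it is obtained by
     truncating [sh M] at 0 and desuspending the triangle. *)
  have [B [A [Y [b [a [h [bah A0 B0]]]]]]] := @le0_truncation _ _
    (dual_brown_abstract bC) (weights_of w) wc (sh M).
  have [h' [_ [_ bah' _]]] := bah.
  have [B' [s [s' [s's ss']]]] := sh_esssurj B.
  have [A' [r [r' [r'r rr']]]] := sh_esssurj A.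
  have [b' b'E] := shm_surj (b ∘ s); have [a' a'E] := shm_surj (r' ∘ a).
  have [|h'' fgh''] := @dist_unshift _ _ _ _ b' a' (shm s' ∘ h' ∘ r).
    apply: (dist_iso (a := s') (c := r') _ (is_iso_id _) _) bah'.
    - by exists s.
    - by exists r.
    - by rewrite b'E hom1l -homA ss' hom1r.
    - by rewrite a'E hom1r.
    - by rewrite -homA rr' hom1r.
  exists B', A', b', a', h''; split=> //.
    move=> X X0; apply/hom0_sh.
    by apply: (hom0_iso (Y := sh X) _ (iso_refl _) (B0 _ X0)); exists s', s.
  by exists A => //; exists r', r.
Qed.

Lemma left_adjoint_heart (t : t_structure C) : w_cosmashing w -> dual_brown C ->
  left_adjacent t w ->
  t_smashing t /\
  equivalent (underlying (opposite (t_heart t))) (product_functors (w_heart w)).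
Proof.
move=> [hP wc] bC tw; split.
  split; first exact: (brown_coproducts (dual_brown_abstract bC)).
  apply: perp_coproducts => X; rewrite (tw X); exact: w_leP.
have := @heart_equivalent _ _ (weights_of w) (dual_brown_abstract bC) wc
  (sh_le_products wc).
have -> : t_heart_ob (weights_of w) = (fun X => t_le t X /\ t_ge t X).
  apply/predeqP => X; split=> -[X0 X1].
    split; first exact/tw.
    apply/t_geP => Y [Y' Y'0 Y'Y]; apply: X1.
    exact: w_le_iso Y'Y (proj1 (tw _) Y'0).
  split; first exact/tw.
  move=> Y Y1; apply: (proj1 (t_geP t X) X1); exists (sh Y); last exact: iso_refl.
  exact/tw.
by [].
Qed.
End LeftAdjoint.

(** * Cardinals *)

Section Cardinals.
Local Open Scope card_scope.

Definition embeds (T U : Type) : Prop := exists f : T -> U, injective f.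

Lemma embeds_trans (T U V : Type) : embeds T U -> embeds U V -> embeds T V.
Proof. by move=> [f fi] [g gi]; exists (g \o f); exact: inj_comp. Qed.

Lemma card_leE (T U : Type) (A : set T) (B : set U) : A #<= B <-> embeds A B.
Proof.
split=> [/card_leP/injfunPex[f _ fi]|[f fi]].
  by exists f => x y; apply: fi; rewrite inE.
by apply/card_leP/injfunPex; exists f => // x y _ _ /fi.
Qed.

Lemma embeds_sigT (T : Type) (A : set T) : embeds A {x | A x} /\ embeds {x | A x} A.
Proof.
split; first exists (fun x : A => exist _ (sval x) (set_mem (svalP x))).
  by move=> x y /(congr1 sval) /= xy; apply: val_inj.
exists (fun x : {x | A x} => SigSub (mem_set (svalP x)) : A).
move=> [x Ax] [y Ay] /(congr1 val) /= xy.
by case: _ / xy Ay => Ay; rewrite (Prop_irrelevance Ax Ay).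
Qed.

Lemma embeds_setT (T : Type) : embeds [set: T] T /\ embeds T [set: T].
Proof.
split; first by exists val; exact: val_inj.
by exists (fun x => SigSub (mem_set (I : [set: T] x))) => x y /(congr1 val).
Qed.

Lemma card_leTE (T U : Type) (B : set U) : [set: T] #<= B <-> embeds T {x | B x}.
Proof.
rewrite card_leE; have [T1 T2] := embeds_setT T; have [B1 B2] := embeds_sigT B.
split=> TB; first exact: embeds_trans (embeds_trans T2 TB) B1.
exact: embeds_trans (embeds_trans T1 TB) B2.
Qed.

(** Zorn's lemma on graphs of partial injections: a maximal graph is total or onto, otherwise one
    more pair could be added. *)
Lemma embeds_total (T U : Type) : embeds T U \/ embeds U T.
Proof.
pose P (R : set (T * U)) := (forall x y y', R (x, y) -> R (x, y') -> y = y') /\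
  (forall x x' y, R (x, y) -> R (x', y) -> x = x').
have [F FP Ftot|R [[Rf Ri] Rmax]] := @Zorn_bigcup (T * U)%type P.
  have common a b : (\bigcup_(X in F) X) a -> (\bigcup_(X in F) X) b ->
      exists X, [/\ F X, X a & X b].
    move=> [X FX Xa] [Y FY Yb].
    by have [XY|YX] := Ftot _ _ FX FY; [exists Y|exists X]; split=> //; auto.
  split=> [x y y'|x x' y] /common h /h [X [FX Xa Xb]]; have [Xf Xi] := FP _ FX.
    exact: Xf Xa Xb.
  exact: Xi Xa Xb.
have [Tdom|/existsNP[x xR]] := pselect (forall x, exists y, R (x, y)).
  left; exists (fun x => sval (cid (Tdom x))) => x x'.
  by case: cid => y Ry; case: cid => y' Ry' /= yy'; apply: Ri Ry _; rewrite yy'.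
have [Uran|/existsNP[y yR]] := pselect (forall y, exists x, R (x, y)).
  right; exists (fun y => sval (cid (Uran y))) => y y'.
  by case: cid => a Ra; case: cid => a' Ra' /= aa'; apply: Rf Ra _; rewrite aa'.
case: (Rmax (R `|` [set (x, y)])); first split.
- by move=> a; left.
- by move=> /(_ (x, y) (or_intror erefl)) Rxy; apply: xR; exists y.
split=> [a b b'|a a' b].
  move=> [Rab|[-> ->]] [Rab'|[]]; [exact: Rf Rab Rab'| | |by []].
    by move=> ax _; case: xR; exists b; rewrite -ax.
  by case: xR; exists b'.
move=> [Rab|[-> ->]] [Rab'|[]]; [exact: Ri Rab Rab'| | |by []].
  by move=> _ by_; case: yR; exists a; rewrite -by_.
by case: yR; exists a'.
Qed.

(* Zorn's lemma yields an injection D * bool -> D with the complement of D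
   finite; the latter is then absorbed by a countable subset of D. *)
Lemma embeds_double (T : Type) : embeds nat T -> embeds (T * bool) T.
Proof.
move=> [u ui].
pose dom (R : set (T * bool * T)) x := exists b y, R (x, b, y).
pose P (R : set (T * bool * T)) := [/\ forall a y y', R (a, y) -> R (a, y') -> y = y',
  forall a a' y, R (a, y) -> R (a', y) -> a = a',
  forall x b, dom R x -> exists y, R (x, b, y) &
  forall a y, R (a, y) -> dom R y].
have [F FP Ftot|R [[Rf Ri Rb Rd] Rmax]] := @Zorn_bigcup (T * bool * T)%type P.
  have common a b : (\bigcup_(X in F) X) a -> (\bigcup_(X in F) X) b ->
      exists X, [/\ F X, X a & X b].
    move=> [X FX Xa] [Y FY Yb].
    by have [XY|YX] := Ftot _ _ FX FY; [exists Y|exists X]; split=> //; auto.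
  split=> [a y y'|a a' y|x b [b' [y [X FX Xxy]]]|a y [X FX Xay]].
  - move=> /common h /h [X [FX Xa Xb]]; have [Xf _ _ _] := FP _ FX; exact: Xf Xa Xb.
  - move=> /common h /h [X [FX Xa Xb]]; have [_ Xi _ _] := FP _ FX; exact: Xi Xa Xb.
  - have [_ _ Xb _] := FP _ FX; have [|z Xz] := Xb x b; first by exists b', y.
    by exists z, X.
  - have [_ _ _ Xd] := FP _ FX; have [b [z Xz]] := Xd _ _ Xay.
    by exists b, z, X.
have fin : finite_set (~` dom R).
  apply/finite_setPn => /card_leTE[v vi].
  have vN n : ~ dom R (sval (v n)) := svalP (v n).
  pose nv n := sval (v n).
  have nvi : injective nv.
    move=> m n mn; apply: vi; move: mn; rewrite /nv.
    case: (v m) (v n) => [x xP] [y yP] /= xy.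
    by case: _ / xy yP => yP; rewrite (Prop_irrelevance xP yP).
  (* On a sequence outside the domain, n and a bit b are sent to 2n + b, which doubles the sequence
     into itself and enlarges [R]. *)
  pose Q : set (T * bool * T) := [set z | exists n (b : bool),
    z = (nv n, b, nv (n.*2 + b)%N)].
  have Qdom x b y : Q (x, b, y) -> exists2 n, x = nv n & y = nv (n.*2 + b)%N.
    by move=> [n [b' [-> -> ->]]]; exists n.
  have dQ n (b : bool) m (c : bool) : (n.*2 + b)%N = (m.*2 + c)%N -> n = m /\ b = c.
    move=> nm; have bc : b = c.
      by have := congr1 odd nm; rewrite !oddD !odd_double !oddb.
    split=> //; move: nm; rewrite bc => /addIn /(congr1 half).
    by rewrite !doubleK.
  have vdom n : (R `|` Q) (nv n, true, nv (n.*2 + true)%N) by right; exists n, true.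
  have domv n : dom (R `|` Q) (nv n) by exists true, (nv (n.*2 + true)%N).
  case: (Rmax (R `|` Q)); first split.
  - by move=> a; left.
  - move=> /(_ (nv 0%N, true, nv 1%N)) h; apply: (vN 0%N); exists true, (nv 1%N).
    by apply: h; right; exists 0%N, true.
  split.
  - move=> [x b] y y' [Ry|Qy] [Ry'|Qy'].
    + exact: Rf Ry Ry'.
    + have [n xn _] := Qdom _ _ _ Qy'.
      by case: (vN n); rewrite -/(nv n) -xn; exists b, y.
    + have [n xn _] := Qdom _ _ _ Qy.
      by case: (vN n); rewrite -/(nv n) -xn; exists b, y'.
    + have [n xn ->] := Qdom _ _ _ Qy; have [m xm ->] := Qdom _ _ _ Qy'.
      by move: xn; rewrite xm => /nvi ->.
  - move=> [x b] [x' b'] y [Ry|Qy] [Ry'|Qy'].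
    + exact: Ri Ry Ry'.
    + have [n _ yn] := Qdom _ _ _ Qy'.
      by case: (vN (n.*2 + b')%N); rewrite -/(nv _) -yn; exact: Rd Ry.
    + have [n _ yn] := Qdom _ _ _ Qy.
      by case: (vN (n.*2 + b)%N); rewrite -/(nv _) -yn; exact: Rd Ry'.
    + have [n -> yn] := Qdom _ _ _ Qy; have [m -> ym] := Qdom _ _ _ Qy'.
      by move: yn; rewrite ym => /nvi/dQ[-> ->].
  - move=> x b [b' [y [Ry|Qy]]].
      by have [|z Rz] := Rb x b; [exists b', y|exists z; left].
    have [n -> _] := Qdom _ _ _ Qy; exists (nv (n.*2 + b)%N); right.
    by exists n, b.
  - move=> [x b] y [Ry|Qy]; last by have [n _ ->] := Qdom _ _ _ Qy.
    by have [c [z Rz]] := Rd _ _ Ry; exists c, z; left.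
have Dinf : infinite_set (dom R).
  move=> Dfin; have : finite_set [set: T].
    by rewrite -(setUv (dom R)) finite_setU.
  by apply/infiniteP/card_leTE; exists (fun n => exist _ (u n) Logic.I) => m n [] /ui.
have /infiniteP/card_leTE[v vi] := Dinf.
pose nv n := sval (v n).
have nvi : injective nv.
  move=> m n mn; apply: vi; move: mn; rewrite /nv.
  case: (v m) (v n) => [x xP] [y yP] /= xy.
  by case: _ / xy yP => yP; rewrite (Prop_irrelevance xP yP).
pose B := range nv `|` ~` dom R.
have /countable_injP[h hi] : countable B.
  have := @bigcup_countable _ _ [set: bool] (fun b => if b then range nv else ~` dom R).
  rewrite (_ : \bigcup_(_ in _) _ = B); last first.
    apply/seteqP; split=> [x [[] _]|x [|]]; [by left|by right| |].
      by exists true.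
    by exists false.
  apply; first exact: countableP.
  move=> [] _; last exact: finite_set_countable.
  by apply: card_le_trans (card_image_le _ _) _; exact: card_lexx.
pose g x := if pselect (B x) then nv (h x) else x.
have gD x : dom R (g x).
  rewrite /g; case: pselect => /= [Bx|/not_orP[_ /contrapT]//].
  exact: (svalP (v _)).
have gi : injective g.
  move=> x y; rewrite /g; case: pselect => /= Bx; case: pselect => /= By.
  - by move=> /nvi; apply: hi; exact: mem_set.
  - by move=> xy; case: By; left; exists (h x).
  - by move=> xy; case: Bx; left; exists (h y).
  - by [].
pose f (z : T * bool) := sval (cid (Rb _ z.2 (gD z.1))).
have fE z : R (g z.1, z.2, f z) := svalP (cid (Rb _ z.2 (gD z.1))).
exists f => -[x b] [y c] xy; have := Ri _ _ _ (fE (x, b)).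
by rewrite xy => /(_ _ (fE (y, c)))[/gi -> ->].
Qed.

Lemma card_ltE (I alpha : Type) (J : set I) :
  card_lt alpha J <-> ~ embeds alpha {k | J k}.
Proof.
rewrite /card_lt; split=> [/andP[_ /negP]|aJ]; first by rewrite card_leTE.
apply/andP; split; last by apply/negP; rewrite card_leTE.
have [//|Ja] := embeds_total alpha {k | J k}.
apply/card_leE; have [_ T2] := embeds_setT alpha; have [B1 _] := embeds_sigT J.
exact: embeds_trans (embeds_trans B1 Ja) T2.
Qed.

Lemma card_lt0 (I alpha : Type) : alpha -> card_lt alpha (set0 : set I).
Proof. by move=> a; apply/card_ltE => -[f _]; case: (f a). Qed.

(** An embedding of [alpha] into the union covers [alpha] by the preimages [A] and [B] of the two
    sets. If [Y] is the larger of them, [alpha] embeds in [Y * bool], so [Y] is infinite and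
    [embeds_double] embeds [alpha] in [Y], hence in [J] or [J']. *)
Lemma card_ltU (I alpha : Type) (J J' : set I) : infinite_set [set: alpha] ->
  card_lt alpha J -> card_lt alpha J' -> card_lt alpha (J `|` J').
Proof.
move=> ainf /card_ltE aJ /card_ltE aJ'; apply/card_ltE => -[f fi].
pose A := {a | J (sval (f a))}; pose B := {a | J' (sval (f a))}.
have sub_embeds (K : set I) : embeds {a | K (sval (f a))} {k | K k}.
  exists (fun a : {a | K (sval (f a))} => exist K (sval (f (sval a))) (svalP a)).
  move=> [a Ka] [b Kb] [].
  move=> ab; have {}ab : a = b.
    apply: fi; case: (f a) (f b) ab => [x xP] [y yP] /= xy.
    by case: _ / xy yP => yP; rewrite (Prop_irrelevance xP yP).
  by case: _ / ab Kb => Kb; rewrite (Prop_irrelevance Ka Kb).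
have cover a : exists z : A + B,
    a = match z with inl x => sval x | inr y => sval y end.
  have [Ja|Ja] := svalP (f a); first by exists (inl (exist _ a Ja)).
  by exists (inr (exist _ a Ja)).
pose c a := sval (cid (cover a)).
have cE a : a = match c a with inl x => sval x | inr y => sval y end.
  exact: (svalP (cid (cover a))).
have main (X Y : Type) (p : alpha -> X + Y) (q : X + Y -> alpha) :
    cancel p q -> embeds X Y -> embeds alpha Y.
  move=> pq [g gi].
  have a2 : embeds alpha (Y * bool).
    exists (fun a => match p a with inl x => (g x, true) | inr y => (y, false) end).
    move=> a b; rewrite -{2}(pq a) -{2}(pq b).
    case: (p a) => x; case: (p b) => y //; last by case=> ->.
    by case=> /gi ->.
  apply: (embeds_trans a2); apply: embeds_double.
  have Yinf : infinite_set [set: Y].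
    move=> Yfin; apply: ainf.
    apply: card_le_finite (_ : finite_set [set: Y * bool]).
      apply/card_leE; have [T1 T2] := embeds_setT alpha.
      have [U1 U2] := embeds_setT (Y * bool).
      exact: embeds_trans (embeds_trans T1 a2) U2.
    by rewrite -setXTT; apply: finite_setX => //; exact: finite_finset.
  move/infiniteP: Yinf => /card_leE natY.
  exact: embeds_trans (embeds_trans (embeds_setT nat).2 natY) (embeds_setT Y).1.
have [AB|BA] := embeds_total A B.
  apply: aJ'; apply: embeds_trans (sub_embeds J').
  by apply: (main A B c (fun z => match z with inl x => sval x | inr y => sval y end)).
apply: aJ; apply: embeds_trans (sub_embeds J).
apply: (main B A (fun a => match c a with inl x => inr x | inr y => inl y end)
  (fun z => match z with inl y => sval y | inr x => sval x end)) => // a.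
by rewrite [RHS]cE; case: (c a).
Qed.
End Cardinals.

(** * Small objects *)

Section Support.
Variable D : preadditive.

Lemma coproduct_desc (I : small) (M : I -> D) (P : D) (i : forall k, hom (M k) P) :
  is_coproduct i -> forall (N : D) (f : forall k, hom (M k) N),
  exists g : hom P N, forall k, g ∘ i k = f k.
Proof. by move=> iP N f; exact: (@product_lift (opposite D) _ _ _ _ iP). Qed.

Lemma coproduct_ext (I : small) (M : I -> D) (P : D) (i : forall k, hom (M k) P) :
  is_coproduct i -> forall (N : D) (g g' : hom P N),
  (forall k, g ∘ i k = g' ∘ i k) -> g = g'.
Proof. by move=> iP N g g'; exact: (@product_ext (opposite D) _ _ _ _ iP). Qed.

(* For a coproduct Q this says that f factors through the direct summand of Q
   indexed by J. *)
Definition supported (I : small) (N : I -> D) (Q : D) (i : forall k, hom (N k) Q)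
    (J : set I) (M : D) (f : hom M Q) : Prop :=
  forall (T : D) (e : hom Q T), (forall k, J k -> e ∘ i k = 0) -> e ∘ f = 0.

Section Properties.
Variables (I : small) (N : I -> D) (Q : D) (i : forall k, hom (N k) Q).

Lemma supported_sub (J J' : set I) (M : D) (f : hom M Q) :
  J `<=` J' -> supported i J f -> supported i J' f.
Proof. by move=> JJ' fJ T e eJ'; apply: fJ => k /JJ'; exact: eJ'. Qed.

Lemma supportedB (J : set I) (M : D) (f g : hom M Q) :
  supported i J f -> supported i J g -> supported i J (f - g).
Proof. by move=> fJ gJ T e eJ; rewrite compBr fJ // gJ // subrr. Qed.

Lemma supportedD (J : set I) (M : D) (f g : hom M Q) :
  supported i J f -> supported i J g -> supported i J (f + g).
Proof. by move=> fJ gJ T e eJ; rewrite homDr fJ // gJ // addr0. Qed.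

Lemma supported_comp (J : set I) (M M' : D) (f : hom M Q) (g : hom M' M) :
  supported i J f -> supported i J (f ∘ g).
Proof. by move=> fJ T e eJ; rewrite homA fJ // comp0l. Qed.

Lemma supported_map (N' : I -> D) (Q' : D) (i' : forall k, hom (N' k) Q')
    (g : forall k, hom (N k) (N' k)) (G : hom Q Q') (J : set I) (M : D)
    (f : hom M Q) :
  (forall k, G ∘ i k = i' k ∘ g k) -> supported i J f -> supported i' J (G ∘ f).
Proof.
move=> GE fJ T e eJ; rewrite homA; apply: fJ => k Jk.
by rewrite -homA GE homA eJ // comp0l.
Qed.

Hypothesis iP : is_coproduct i.

(** The idempotent of [Q] projecting onto the summands indexed by [J]; it stands in for the
    subcoproduct. *)
Lemma coproduct_cut (J : set I) :
  exists e : hom Q Q, (forall k, J k -> e ∘ i k = i k) /\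
    (forall k, ~ J k -> e ∘ i k = 0).
Proof.
have [e eE] := coproduct_desc iP
  (fun k => if pselect (J k) then i k else 0).
by exists e; split=> k Jk; rewrite eE; case: pselect.
Qed.

Lemma supported_cut (J : set I) (M : D) (f : hom M Q) (e : hom Q Q) :
  (forall k, J k -> e ∘ i k = i k) -> supported i J f -> e ∘ f = f.
Proof.
move=> eJ fJ; apply/eqP; rewrite -subr_eq0 -{2}(hom1l f) -compBl; apply/eqP.
by apply: fJ => k Jk; rewrite compBl eJ // hom1l subrr.
Qed.

Lemma cut_supported (J : set I) (M : D) (f : hom M Q) (e : hom Q Q) :
  (forall k, J k -> e ∘ i k = i k) -> (forall k, ~ J k -> e ∘ i k = 0) ->
  supported i J (e ∘ f).
Proof.
move=> eJ eJc T u uJ; suff ue : u ∘ e = 0 by rewrite homA ue comp0l.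
apply: (coproduct_ext iP) => k; rewrite comp0l -homA.
have [Jk|Jk] := pselect (J k); first by rewrite eJ // uJ.
by rewrite eJc // comp0r.
Qed.

End Properties.

Variables (alpha : small) (alpha_inf : infinite_set [set: alpha]).
Hypothesis coproducts : has_coproducts D.

Definition small_support (M : D) : Prop :=
  forall (I : small) (N : I -> D) (Q : D) (i : forall k, hom (N k) Q),
  is_coproduct i -> forall f : hom M Q, exists J, card_lt alpha J /\ supported i J f.

Lemma card_lt_set0 (I : Type) : card_lt alpha (set0 : set I).
Proof.
have [na|a] := pselectT alpha; last exact: card_lt0.
exfalso; apply: alpha_inf.
suff -> : [set: alpha] = set0 by exact: finite_set0.
by apply/seteqP; split=> [a _|//]; case: (na a).
Qed.

(** The morphisms with small support form a subgroup of [hom M Q]. The projection to the quotient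
    and the zero map both factor the zero cocone, so uniqueness in the colimit makes the projection
    vanish. *)
Lemma alpha_small_support M : alpha_small alpha M -> small_support M.
Proof.
move=> Msmall I N Q i iP f.
pose P0 (J : {J : set I | card_lt alpha J}) :=
  cid (coproducts (fun k : {k | sval J k} => N (sval k))).
pose P J : D := sval (P0 J).
pose P1 J := cid (svalP (P0 J)).
pose i_ J : forall k : {k | sval J k}, hom (N (sval k)) (P J) := sval (P1 J).
have i_P J : @is_coproduct D {k | sval J k} (fun k => N (sval k)) (P J) (i_ J).
  exact: (svalP (P1 J)).
pose S (g : hom M Q) := exists J, card_lt alpha J /\ supported i J g.
have S0 : S 0.
  by exists set0; split; [exact: card_lt_set0|move=> T e _; exact: comp0r].
have SB g h : S g -> S h -> S (g - h).
  move=> [J [Ja gJ]] [J' [J'a hJ]]; exists (J `|` J'); split.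
    exact: card_ltU.
  apply: supportedB; [apply: supported_sub gJ|apply: supported_sub hJ].
    by move=> k; left.
  by move=> k; right.
have [A [q [_ qker]]] := quotient_ex S0 SB.
have [v _ vU] := Msmall I N P i_ Q i i_P iP A (fun J => \0)
  (fun _ _ _ _ _ _ => erefl).
have v0 : \0 =1 v by apply: vU.
have vq : q =1 v.
  apply: vU => J s sE g; have [_] := qker (s ∘ g); apply.
  exists (sval J); split; first exact: (svalP J).
  move=> T e eJ; rewrite homA; suff -> : e ∘ s = 0 by rewrite comp0l.
  by apply: (coproduct_ext (i_P J)) => k; rewrite -homA sE comp0l eJ //; exact: (svalP k).
by apply/qker; rewrite vq -v0.
Qed.

(** The factorization sends [f] to [u J (r J ∘ f)] for any [J] supporting [f], where [r J] projects
    onto the subcoproduct. Two choices of [J] are compared in their union, which is also where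
    additivity is checked. *)
Lemma support_alpha_small M : small_support M -> alpha_small alpha M.
Proof.
move=> Msupp I N P i_ Q i i_P iP A u uE factors.
have sex J : exists s : hom (P J) Q, forall k, s ∘ i_ J k = i (sval k).
  exact: (coproduct_desc (i_P J)).
pose s J := sval (cid (sex J)).
have sE J k : s J ∘ i_ J k = i (sval k) := svalP (cid (sex J)) k.
have rex J : exists r : hom Q (P J), forall k, r ∘ i k =
    match pselect (sval J k) with left h => i_ J (exist _ k h) | right _ => 0 end.
  exact: (coproduct_desc iP).
pose r J := sval (cid (rex J)).
have rE J (k : {k | sval J k}) : r J ∘ i (sval k) = i_ J k.
  rewrite (svalP (cid (rex J))); case: k => k kP /=.
  by case: pselect => // h; rewrite (Prop_irrelevance h kP).
have rs J : r J ∘ s J = idm (P J).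
  by apply: (coproduct_ext (i_P J)) => k; rewrite -homA sE rE hom1l.
have sr J (f : hom M Q) : supported i (sval J) f -> s J ∘ (r J ∘ f) = f.
  move=> fJ; rewrite homA; apply: supported_cut fJ => k Jk.
  by rewrite -homA; have := sE J (exist _ k Jk); rewrite -rE.
have u_sub (J J' : {J : set I | card_lt alpha J}) (f : hom M Q) :
    sval J `<=` sval J' -> supported i (sval J) f ->
    u J (r J ∘ f) = u J' (r J' ∘ f).
  move=> JJ' fJ.
  have [t tE] := coproduct_desc (i_P J)
    (fun k => i_ J' (exist _ (sval k) (JJ' _ (svalP k)))).
  rewrite -(uE J J' JJ' t tE); congr (u J' _).
  have st : s J' ∘ t = s J.
    apply: (coproduct_ext (i_P J)) => k; rewrite -homA tE.
    by have /= -> := sE J' (exist _ (sval k) (JJ' _ (svalP k))); rewrite sE.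
  by rewrite -(hom1l (t ∘ _)) -rs -homA (homA _ t) st sr.
pose SU (J J' : {J : set I | card_lt alpha J}) : {J : set I | card_lt alpha J} :=
  exist _ (sval J `|` sval J') (card_ltU alpha_inf (svalP J) (svalP J')).
have SUl J J' : sval J `<=` sval (SU J J') by move=> k; left.
have SUr J J' : sval J' `<=` sval (SU J J') by move=> k; right.
have Jex (f : hom M Q) : exists J : {J : set I | card_lt alpha J},
    supported i (sval J) f.
  by have [J [Ja fJ]] := Msupp _ _ _ _ iP f; exists (exist _ J Ja).
pose J0 f := sval (cid (Jex f)).
have J0P f : supported i (sval (J0 f)) f := svalP (cid (Jex f)).
pose v f := u (J0 f) (r (J0 f) ∘ f).
have vE J f : supported i (sval J) f -> v f = u J (r J ∘ f).
  move=> fJ; rewrite /v (u_sub _ _ _ (SUl _ J) (J0P f)).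
  by rewrite (u_sub _ _ _ (SUr (J0 f) J) fJ).
have vB : zmod_morphism v.
  move=> f g; have fS := supported_sub (SUl (J0 f) (J0 g)) (J0P f).
  have gS := supported_sub (SUr (J0 f) (J0 g)) (J0P g).
  by rewrite (vE _ _ fS) (vE _ _ gS) (vE _ _ (supportedB fS gS)) compBr raddfB.
exists (HB.pack_for {additive hom M Q -> A} v
    (GRing.isZmodMorphism.Build _ _ v vB)) => [J s' s'E f|v' v'E f] /=.
  have -> : s' = s J by apply: (coproduct_ext (i_P J)) => k; rewrite s'E sE.
  rewrite (vE J) ?homA ?rs ?hom1l // => T e eJ.
  rewrite homA; suff -> : e ∘ s J = 0 by rewrite comp0l.
  by apply: (coproduct_ext (i_P J)) => k; rewrite -homA sE comp0l eJ //; exact: (svalP k).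
by rewrite -{1}(sr _ _ (J0P f)) (v'E _ _ (sE _)).
Qed.

End Support.

(** * Closure properties of the small objects *)

Section AlphaSmall.
Variables (C : triangulated) (alpha : small).
Hypothesis alpha_inf : infinite_set [set: alpha].
Hypothesis coproducts : has_coproducts C.

Lemma alpha_smallP (M : C) : alpha_small alpha M <-> small_support alpha M.
Proof.
split; first exact: alpha_small_support.
exact: support_alpha_small.
Qed.

Lemma small_support_iso : closed_under_isos (@small_support C alpha).
Proof.
move=> X Y [f [g [gf fg]]] Xs I N Q i iP h.
have [J [Ja hJ]] := Xs I N Q i iP (h ∘ f); exists J; split=> //.
by rewrite -(hom1r h) -fg homA; exact: supported_comp.
Qed.

Lemma small_support_unsh (X : C) : small_support alpha (sh X) -> small_support alpha X.
Proof.
move=> Xs I N Q i iP f; have [J [Ja fJ]] := Xs I _ _ _ (sh_coproduct iP) (shm f).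
exists J; split=> // T e eJ; apply: shm_inj; rewrite raddf0 shm_comp.
by apply: fJ => k Jk; rewrite -shm_comp eJ // raddf0.
Qed.

(** The summands are replaced by shifts of objects [N' k], so that [f] becomes the shift of a
    morphism from [X] to the coproduct of the [N' k]. *)
Lemma small_support_sh (X : C) : small_support alpha X -> small_support alpha (sh X).
Proof.
move=> Xs I N Q i iP f.
pose N' k := sval (cid (sh_esssurj (N k))).
have Nex k : isomorphic (sh (N' k)) (N k) := svalP (cid (sh_esssurj (N k))).
pose a k := sval (cid (Nex k)).
have [R [j jP]] := coproducts N'.
have jP' := sh_coproduct jP.
have [G GE] := coproduct_desc jP' (fun k => i k ∘ a k).
pose b k := sval (cid (svalP (cid (Nex k)))).
have ab k : a k ∘ b k = idm (N k) by have [] := svalP (cid (svalP (cid (Nex k)))).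
have [H HE] := coproduct_desc iP (fun k => shm (j k) ∘ b k).
have GH : G ∘ H = idm Q.
  by apply: (coproduct_ext iP) => k; rewrite -homA HE homA GE -homA ab hom1r hom1l.
have [f' f'E] := shm_surj (H ∘ f).
have [J [Ja fJ]] := Xs I N' R j jP f'; exists J; split=> //.
rewrite -(hom1l f) -GH -homA -f'E; apply: (supported_map GE) => T e eJ.
have [T' [s [s' [s's ss']]]] := sh_esssurj T.
have [e' e'E] := shm_surj (s' ∘ e).
suff e'f : e' ∘ f' = 0.
  by rewrite -(hom1l (e ∘ _)) -ss' -homA (homA s') -e'E -shm_comp e'f raddf0 comp0r.
apply: fJ => k Jk; apply: shm_inj; rewrite raddf0 shm_comp e'E -homA eJ //.
exact: comp0r.
Qed.

(** On [Y] the morphism [u] is supported on [J]. After cutting [u] down to [J], the remainder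
    vanishes on [Y], so it factors through [sh X], which contributes a second support [J']. *)
Lemma small_support_cone (X Y Z : C) (f : hom X Y) (g : hom Y Z) (h : hom Z (sh X)) :
  dist f g h -> small_support alpha X -> small_support alpha Y ->
  small_support alpha Z.
Proof.
move=> fgh /small_support_sh Xs Ys I N Q i iP u.
have [J [Ja uJ]] := Ys I N Q i iP (u ∘ g).
have [e [eJ eJc]] := coproduct_cut iP J.
have ug : (u - e ∘ u) ∘ g = 0.
  by rewrite compBl -homA (supported_cut eJ uJ) subrr.
have [y yE] := dist_desc ((dist_rot _ _ _).1 fgh) ug.
have [J' [J'a yJ]] := Xs I N Q i iP y.
exists (J `|` J'); split; first exact: card_ltU.
have -> : u = e ∘ u + y ∘ h by rewrite -yE addrC subrK.
apply: supportedD.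
  by apply: (supported_sub _ (cut_supported iP u eJ eJc)) => k; left.
by apply: supported_comp; apply: (supported_sub _ yJ) => k; right.
Qed.

Lemma alpha_small_triangulated : triangulated_class (@alpha_small C alpha).
Proof.
split.
- by move=> X Y XY /alpha_smallP Xs; apply/alpha_smallP; exact: small_support_iso Xs.
- have [O O0] := zero_ex C; exists O => //; apply/alpha_smallP => I N Q i iP f.
  exists set0; split; first exact: card_lt_set0.
  by move=> T e _; rewrite -(hom1r f) O0 !comp0r.
- move=> X; rewrite !alpha_smallP.
  by split; [exact: small_support_sh|exact: small_support_unsh].
- move=> X Y Z f g h fgh; rewrite !alpha_smallP; exact: small_support_cone fgh.
Qed.

Variable w : weight_structure C.
Hypothesis w_ge_coproducts : closed_under_coproducts (w_ge w).

(* A morphism from the truncation B to a coproduct lifts to the coproduct of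
   the weight truncations of the summands, which again has weight at most -1,
   so that the lift is determined by its restriction to M. *)
Lemma truncation_small (M B : C) (b : hom M B) :
  w_le w (sh B) ->
  (forall Y, w_le w (sh Y) -> forall f : hom B Y, f ∘ b = 0 -> f = 0) ->
  small_support alpha M -> small_support alpha B.
Proof.
move=> B1 binj Ms I N Q i iP f.
have [L] := choice_family (fun k => w_decompm1 w (N k)).
move=> /choice_family[R] /choice_family[Z] /choice_family[l] /choice_family[r].
move=> /choice_family[z lrz].
have L1 k : w_le w (sh (L k)) by have [] := lrz k.
have R0 k : w_ge w (R k) by have [] := lrz k.
have tlr k : exists V (v : hom V (L k)), ctri v (l k) (r k).
  by have [_ _ /ctri_unrot] := lrz k.
have [V /choice_family[v vlr]] := choice_family tlr.
have [PL [p pP]] := coproducts L; have [PR [q qP]] := coproducts R.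
have PR0 : w_ge w PR by apply: w_ge_coproducts qP _.
have PL1 : w_le w (sh PL).
  apply: (perp_coproducts (A := fun X => w_le w (sh X)) (B := w_ge w) _ pP) => //.
  by move=> X; exact: w_lem1P.
have [F FE] := coproduct_desc pP (fun k => i k ∘ l k).
have [G GE] := coproduct_desc iP
  (fun k => @mcomp C (N k) (R k) PR (q k) (r k)).
have Gf : G ∘ f = 0 by apply: (proj1 (w_geP w PR) PR0 B).
(* Descent along products of triangles, read in the opposite category, lifts [f] along the coproduct
   of the truncations. *)
have [f' f'E] : exists f' : hom B PL, f = F ∘ f'.
  exact: (@product_desc _ (op_triangulation_of C) _ R N L V r l v PR Q PL q i p
    G F vlr qP iP pP GE FE _ f Gf).
have [J [Ja fJ]] := Ms I L PL p pP (f' ∘ b).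
have [e [eJ eJc]] := coproduct_cut pP J.
exists J; split=> //; rewrite f'E; apply: (supported_map FE).
have -> : f' = e ∘ f'.
  apply/eqP; rewrite -subr_eq0; apply/eqP/(binj _ PL1).
  by rewrite compBl -homA (supported_cut eJ fJ) subrr.
exact: (cut_supported pP f' eJ eJc).
Qed.

End AlphaSmall.

(** * The restricted t-structure *)

(** The axioms are propositions, so the two classes determine a t-structure and uniqueness can be
    stated as an equality. *)
Lemma t_structure_ext (C : triangulated) (t t' : t_structure C) :
  (forall X, t_le t X <-> t_le t' X) -> (forall X, t_ge t X <-> t_ge t' X) -> t = t'.
Proof.
case: t => le ge p1 p2 p3 p4 p5 p6; case: t' => le' ge' q1 q2 q3 q4 q5 q6 /=.
move=> /predeqP ele /predeqP ege; subst le' ge'.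
congr TStructure; exact: Prop_irrelevance.
Qed.

Section Restriction.
Variables (C : triangulated) (w : weight_structure C) (t : t_structure C).
Variable alpha : small.
Hypothesis alpha_inf : infinite_set [set: alpha].
Hypotheses (tw : left_adjacent t w) (ws : w_smashing w).

Let DP : triangulated_class (@alpha_small C alpha) :=
  alpha_small_triangulated alpha_inf ws.1.
Local Notation S := (sub_triangulated DP).

Lemma sub_iso (X Y : S) : isomorphic X Y <-> isomorphic (sval X) (sval Y).
Proof. by split=> -[f [g [? ?]]]; exists f, g. Qed.

Lemma sub_shift (A : C -> Prop) (X : S) : closed_under_isos A ->
  (exists2 X', A X' & isomorphic (sh X') (sval X)) <->
  @shift S (fun Y => A (sval Y)) X.
Proof.
move=> Ai; split=> [[X' AX' X'X]|[X' AX' X'X]]; last first.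
  by exists (sval X') => //; exact: (sub_iso _ _).1 X'X.
have X's : alpha_small alpha X'.
  apply/(tclass_sh DP); apply: tclass_iso (svalP X) => //; exact: iso_sym.
by exists (exist _ X' X's : S) => //; apply/sub_iso.
Qed.

(** It suffices that the truncations of a small [M] are small: [R] by [truncation_small], then
    [sh L] as the cone of [M -> R]. *)
Lemma restricted_t_structure_ex :
  exists t' : t_structure S, is_restriction t t'.
Proof.
unshelve eexists (@TStructure S (fun X => t_le t (sval X))
  (fun X => t_ge t (sval X)) _ _ _ _ _ _) => //.
- by move=> X Y /sub_iso; exact: t_le_iso.
- by move=> X Y /sub_iso; exact: t_ge_iso.
- by move=> X /t_le_shift/(sub_shift X (@t_le_iso _ t)).
- by move=> X /(sub_shift X (@t_ge_iso _ t))/t_ge_shift.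
- move=> X Y f /(sub_shift X (@t_ge_iso _ t)) X1 Y0.
  exact: (t_perp (f : @hom C (sval X) (sval Y)) X1 Y0).
- move=> M; have [L [R [f [g [h [L0 R1 fgh]]]]]] := t_decomp t (sval M).
  have shR0 : t_le t (sh R) by have [R' R'0 R'R] := R1; exact: t_le_iso R'R R'0.
  have Rs : alpha_small alpha R.
    apply/(alpha_smallP alpha_inf ws.1).
    apply: (truncation_small ws.1 ws.2 (b := g)) _ _ _; first exact/tw.
      (* A morphism from [R] that vanishes on [M] factors through [sh L], which has no nonzero
         morphism to weight at most -1. *)
      move=> Y Y1 u ug; have [k ->] := dist_desc ((dist_rot _ _ _).1 fgh) ug.
      have -> : k = 0.
        apply: (t_ge_hom0 (t_ge_shift (sh_shift L0))); exists (sh Y).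
          exact/tw.
        exact: iso_refl.
      by rewrite comp0l.
    apply/(alpha_smallP alpha_inf ws.1); exact: (svalP M).
  have Ls : alpha_small alpha L.
    apply/(tclass_sh DP).
    exact: (tclass_cone DP ((dist_rot _ _ _).1 fgh) (svalP M) Rs).
  exists (exist _ L Ls), (exist _ R Rs), f, g, h; split=> //.
  by exists (sh (exist _ R Rs : S)) => //; exact: iso_refl.
Qed.

Lemma restriction_left_orthogonal (t' : t_structure S) :
  is_restriction t t' -> left_orthogonal t' w.
Proof.
move=> tt' X Y f; split.
  move=> [X' X'0 X'X] Y0; apply: (@t_perp _ t); last exact/tw.
  exists (sval X'); first exact/(tt' X').2.
  exact: ((sub_iso _ _).1 X'X).
move=> [X' X'0 X'X] Y0.
suff X1 : w_le w (sh (sval X)) by exact: (proj1 (w_lem1P w _) X1).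
apply: (w_le_iso _ (proj1 (tw _) ((tt' X').1.1 X'0))).
exact: (sub_iso _ _).1 X'X.
Qed.

(** Orthogonality to [w] places each half of [t''] inside the corresponding half of [t']. As the
    halves of a t-structure are orthogonals of each other, each inclusion yields the reverse
    inclusion for the other half. *)
Lemma left_orthogonal_unique (t' t'' : t_structure S) :
  is_restriction t t' -> left_orthogonal t'' w -> t'' = t'.
Proof.
move=> tt' orth.
have ge_sub X : t_ge t'' X -> t_ge t' X.
  move=> X0; apply/(tt' X).2/t_geP => Y [Y' Y'0 Y'Y]; apply/hom0_sh => f.
  have [o _] := orth (sh X) (sh Y) f; apply: o; first exact: sh_shift.
  exact: w_le_iso Y'Y (proj1 (tw _) Y'0).
have le_sub X : t_le t'' X -> t_le t' X.
  move=> X0; have [X1 X1X] := sh_esssurj X.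
  apply/(tt' X).1/tw; apply: (w_le_iso ((sub_iso _ _).1 X1X)).
  apply/w_lem1P => Y Y0 f; have [_ o] := orth X1 Y f; apply: o => //.
  by exists X => //; exact: iso_sym.
apply: t_structure_ext => X; split; [exact: le_sub| |exact: ge_sub|].
  move=> X0; apply/t_leP => Y [Z Z0 ZY] f; apply: (@t_perp _ t') => //.
  by exists Z => //; exact: ge_sub.
move=> X0; apply/t_geP => Y [Z Z0 ZY]; apply: (t_ge_hom0 X0).
by exists Z => //; exact: le_sub.
Qed.

End Restriction.

Theorem theorem3p2p3 (C : triangulated) (w : weight_structure C) :
  (brown C ->
     ((exists t : t_structure C, right_adjacent t w) <-> w_smashing w) /\
     (forall t : t_structure C, right_adjacent t w ->
        t_cosmashing t /\
        equivalent (underlying (t_heart t))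
                   (product_functors (opposite (w_heart w)))))
  /\
  (w_cosmashing w -> dual_brown C ->
     exists t : t_structure C,
       [/\ t_smashing t,
           left_adjacent t w,
           equivalent (underlying (opposite (t_heart t)))
                      (product_functors (w_heart w)) &
           w_smashing w ->
           forall alpha : small, infinite_set [set: alpha] ->
             exists (D : triangulated_class (@alpha_small C alpha))
                    (ta : t_structure (sub_triangulated D)),
               [/\ is_restriction t ta,
                   left_orthogonal ta w &
                   forall t' : t_structure (sub_triangulated D),
                     left_orthogonal t' w -> t' = ta]]).
Proof.
split=> [bC|wc bC].
  split; last by move=> t; exact: right_adjoint_heart.
  by split=> [[t tw]|]; [exact: right_adjoint_smashing tw|exact: right_adjoint_exists].
have [t tw] := left_adjoint_exists wc bC.
have [ts te] := left_adjoint_heart wc bC tw.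
exists t; split=> // ws alpha alpha_inf.
have [ta tta] := restricted_t_structure_ex alpha_inf tw ws.
exists (alpha_small_triangulated alpha_inf ws.1), ta; split=> //.
- exact: restriction_left_orthogonal.
- by move=> t'; exact: left_orthogonal_unique.
Qed.
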